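(* Under the setting and standing assumptions (A) described in the context, the matrix $\Sigma$ is invertible. Let $f\in\mathcal H$ and $\delta\in(0,1)$. If \[ m\ge\frac{8}{3}\,R\,\|\Sigma\|\,\|\Sigma^{-1}\|^2\log(2n/\delta), \] then with probability at least $1-\delta$ the matrix $\widehat\Sigma_\Omega$ is invertible, so that the weighted least-squares problem \[ \operatorname*{argmin}_{x\in\mathbb C^n}\sum_{t=1}^m\frac{1}{p_{i_t}}\big|\langle W\iota_n x,s_{i_t}\rangle-\langle f,s_{i_t}\rangle\big|^2 \] has a unique solution $\tilde x$, and the reconstruction $\tilde f:=W\iota_n\tilde x$ satisfies \[ \|f-\tilde f\|\le\|P_{\mathcal W_n^\perp}f\|\,\big(1+K_{n,\Omega}^2\big)^{1/2},\qquad K_{n,\Omega}:=\|W\iota_n\widehat\Sigma_\Omega^{-1}\widehat\Gamma_\Omega\|. \]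
   Context: Let $\mathcal H$ be a separable complex Hilbert space, $\mathbb N=\{1,2,\dots\}$, and $\ell^2=\ell^2(\mathbb N)$ with canonical orthonormal basis $(e_j)_{j\in\mathbb N}$. For vectors $a,b$ in Hilbert spaces, $a\otimes b$ denotes the rank-one operator $x\mapsto\langle x,b\rangle a$. Let $\iota_n:\mathbb C^n\to\ell^2$, $\iota_n(x_1,\dots,x_n)=(x_1,\dots,x_n,0,0,\dots)$; its adjoint $\iota_n^*$ keeps the first $n$ entries of a sequence. Let $(s_k)_{k\in\mathbb N}\subset\mathcal H$ be a frame for its closed linear span $\mathcal S$: there are constants $0<A\le B$ with $A\|h\|^2\le\sum_k|\langle h,s_k\rangle|^2\le B\|h\|^2$ for all $h\in\mathcal S$. Let $(w_k)_{k\in\mathbb N}\subset\mathcal H$ be a Riesz basis for its closed linear span $\mathcal W$: there are constants $0<C\le D$ with $C\|x\|^2\le\|\sum_kx_kw_k\|^2\le D\|x\|^2$ for all $x\in\ell^2$. Synthesis operators $S,W:\ell^2\to\mathcal H$: $Sx=\sum_kx_ks_k$, $Wx=\sum_kx_kw_k$; so $S^*h=(\langle h,s_k\rangle)_k$, $W^*h=(\langle h,w_k\rangle)_k$. Put $U:=S^*W:\ell^2\to\ell^2$. Fix $n\in\mathbb N$, $\mathcal W_n:=\operatorname{span}\{w_1,\dots,w_n\}$, and let $P_{\mathcal W_n^\perp}$ be the orthogonal projection onto $\mathcal W_n^\perp$. Define the $n\times n$ matrix $\Sigma:=\iota_n^*U^*U\iota_n$, vectors $v_j:=\iota_n^*U^*e_j\in\mathbb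 C^n$ and $u_j:=P_{\mathcal W_n^\perp}s_j\in\mathcal H$ ($j\in\mathbb N$), and the cross-term operator $\Gamma:=\iota_n^*U^*S^*P_{\mathcal W_n^\perp}:\mathcal H\to\mathbb C^n$. Let $p=(p_j)_{j\in\mathbb N}$ be a probability distribution on $\mathbb N$ with $\operatorname{supp}(p)=\{j:p_j>0\}$; set $R:=\sup_{j\in\operatorname{supp}(p)}\|v_j\|^2/p_j$ and $R':=\sup_{j\in\operatorname{supp}(p)}\|u_j\|^2/p_j$. Let $m\in\mathbb N$ and let $i_1,\dots,i_m$ be i.i.d. random indices with law $p$, $\Omega=\{i_1,\dots,i_m\}$. Define $Q_\Omega:=\frac1m\sum_{t=1}^m\frac{e_{i_t}\otimes e_{i_t}}{p_{i_t}}$, the empirical Gram matrix $\widehat\Sigma_\Omega:=\iota_n^*U^*Q_\Omega U\iota_n$ and the empirical cross-term $\widehat\Gamma_\Omega:=\iota_n^*U^*Q_\Omega S^*P_{\mathcal W_n^\perp}:\mathcal H\to\mathbb C^n$. Standing assumptions (A): (i) $\mathcal W\cap\mathcal S^\perp=\{0\}$; (ii) $R<\infty$ and $R'<\infty$; (iii) $p_j>0$ whenever $v_j\neq0$. *)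

(* Defs.v *)
From HB Require Import structures.
From mathcomp Require Import all_boot all_order all_algebra.
From mathcomp Require Import all_classical all_reals all_analysis.
From mathcomp Require Import complex.
Set Implicit Arguments. Unset Strict Implicit. Unset Printing Implicit Defensive.
Import Order.TTheory GRing.Theory Num.Theory.
Local Open Scope classical_set_scope.
Local Open Scope ring_scope.

Section Defs.
Variable R : realType.
Local Notation C := R[i].

Definition cconj (z : C) : C := complex.Complex (complex.Re z) (- complex.Im z).
Definition cmod2 (z : C) : R := complex.Re z ^+ 2 + complex.Im z ^+ 2.

Section Hilbert.
Variable V : lmodType C.
Variable ip : V -> V -> C.

Definition hnorm (x : V) : R := Num.sqrt (complex.Re (ip x x)).

Definition hconv (u : nat -> V) (l : V) :=
  forall e : R, 0 < e -> exists N : nat, forall k, (N <= k)%N -> hnorm (u k - l) < e.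

Record is_hilbert : Prop := IsHilbert {
  ip_linl : forall (a : C) x y z, ip (a *: x + y) z = a * ip x z + ip y z;
  ip_sym : forall x y, ip y x = cconj (ip x y);
  ip_pos : forall x, 0 <= complex.Re (ip x x);
  ip_def : forall x, ip x x = 0 -> x = 0;
  ip_complete : forall u : nat -> V,
     (forall e : R, 0 < e -> exists N : nat, forall k l, (N <= k)%N -> (N <= l)%N ->
        hnorm (u k - u l) < e) -> exists l, hconv u l;
  ip_separable : exists d : nat -> V, forall x (e : R), 0 < e -> exists k, hnorm (x - d k) < e
}.

Definition in_cspan (s : nat -> V) (h : V) :=
  forall e : R, 0 < e -> exists (N : nat) (c : nat -> C),
    hnorm (h - \sum_(k < N) c k *: s k) < e.

Definition in_cspan_perp (s : nat -> V) (h : V) :=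
  forall g, in_cspan s g -> ip h g = 0.

(* elements of l^2 (indices shifted to start at 0) and the squared l^2 norm *)
Definition is_l2 (x : nat -> C) := exists M : R, forall N, \sum_(k < N) cmod2 (x k) <= M.
Definition l2norm2 (x : nat -> C) : \bar R := (\sum_(k <oo) (cmod2 (x k))%:E)%E.

Definition is_frame (s : nat -> V) (A B : R) :=
  0 < A /\ A <= B /\
  forall h, in_cspan s h ->
    ((A * hnorm h ^+ 2)%:E <= \sum_(k <oo) (cmod2 (ip h (s k)))%:E <= (B * hnorm h ^+ 2)%:E)%E.

Definition psum (w : nat -> V) (x : nat -> C) (N : nat) : V := \sum_(k < N) x k *: w k.

Definition is_riesz (w : nat -> V) (Cc D : R) :=
  0 < Cc /\ Cc <= D /\
  forall x, is_l2 x -> exists y, hconv (psum w x) y /\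
    (Cc%:E * l2norm2 x <= (hnorm y ^+ 2)%:E <= D%:E * l2norm2 x)%E.

Definition synth (w : nat -> V) (x : nat -> C) : V := xget 0 [set y | hconv (psum w x) y].
Definition anal (s : nat -> V) (h : V) : nat -> C := fun k => ip h (s k).

Definition cconv (u : nat -> C) (l : C) :=
  forall e : R, 0 < e -> exists N : nat, forall k, (N <= k)%N ->
     cmod2 (\sum_(j < k) u j - l) < e ^+ 2.
Definition csum (u : nat -> C) : C := xget 0 [set l | cconv u l].
Definition l2ip (x y : nat -> C) : C := csum (fun k => x k * cconj (y k)).

Definition ebasis (j : nat) : nat -> C := fun k => (k == j)%:R.
Definition iota_n (n : nat) (x : 'cV[C]_n) : nat -> C :=
  fun k => if (k < n)%N =P true is ReflectT H then x (Ordinal H) 0 else 0.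
Definition iota_adj (n : nat) (y : nat -> C) : 'cV[C]_n := \col_(i < n) y i.

Definition projWnperp (w : nat -> V) (n : nat) (x : V) : V :=
  xget 0 [set y | (forall i : 'I_n, ip y (w i) = 0) /\
                  exists c : 'I_n -> C, x - y = \sum_(i < n) c i *: w i].

Section Ops.
Variables (s w : nat -> V) (n : nat).
Definition Uop (x : nat -> C) : nat -> C := anal s (synth w x).
Definition Uadj (y : nat -> C) : nat -> C := anal w (synth s y).
(* Sigma = iota^* U^* U iota *)
Definition Sigma : 'M[C]_n :=
  \matrix_(i < n, j < n) l2ip (Uop (iota_n (delta_mx j 0))) (Uop (iota_n (delta_mx i 0))).
Definition vvec (j : nat) : 'cV[C]_n := iota_adj n (Uadj (ebasis j)).
Definition uvec (j : nat) : V := projWnperp w n (s j).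
Definition Qop (p : nat -> R) (m : nat) (om : {ffun 'I_m -> nat}) (x : nat -> C) : nat -> C :=
  fun k => \sum_(t < m) (complex.Complex ((m%:R)^-1 * (p (om t))^-1) 0) * ((om t == k)%:R * x k).
Definition Sigmahat (p : nat -> R) (m : nat) (om : {ffun 'I_m -> nat}) : 'M[C]_n :=
  \matrix_(i < n, j < n)
    l2ip (Qop p om (Uop (iota_n (delta_mx j 0)))) (Uop (iota_n (delta_mx i 0))).
Definition Gammahat p m (om : {ffun 'I_m -> nat}) (h : V) : 'cV[C]_n :=
  iota_adj n (Uadj (Qop p om (anal s (projWnperp w n h)))).
End Ops.

Definition hopnorm (T : V -> V) : R := sup [set hnorm (T h) | h in [set h | hnorm h <= 1]].
End Hilbert.

Definition vnorm (n : nat) (x : 'cV[C]_n) : R := Num.sqrt (\sum_(i < n) cmod2 (x i 0)).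
Definition mxopnorm (n : nat) (M : 'M[C]_n) : R :=
  sup [set vnorm (M *m x) | x in [set x : 'cV[C]_n | vnorm x <= 1]].

Definition Rconst (V : lmodType C) (ip : V -> V -> C) (s w : nat -> V) (n : nat) (p : nat -> R)
  : \bar R :=
  ereal_sup [set (vnorm (vvec ip s w n j) ^+ 2 / p j)%:E | j in [set j | 0 < p j]].
Definition Rconst' (V : lmodType C) (ip : V -> V -> C) (s w : nat -> V) (n : nat) (p : nat -> R)
  : \bar R :=
  ereal_sup [set (hnorm ip (uvec ip s w n j) ^+ 2 / p j)%:E | j in [set j | 0 < p j]].

Definition wls_obj (V : lmodType C) (ip : V -> V -> C) (s w : nat -> V) (n : nat) (p : nat -> R)
  (f : V) (m : nat) (om : {ffun 'I_m -> nat}) (x : 'cV[C]_n) : R :=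
  \sum_(t < m) (p (om t))^-1 *
     cmod2 (ip (synth ip w (iota_n x)) (s (om t)) - ip f (s (om t))).

Definition Kconst (V : lmodType C) (ip : V -> V -> C) (s w : nat -> V) (n : nat) (p : nat -> R)
  (m : nat) (om : {ffun 'I_m -> nat}) : R :=
  hopnorm ip (fun h => synth ip w (iota_n (invmx (Sigmahat ip s w n p om) *m Gammahat ip s w n p om h))).

Definition good_event (V : lmodType C) (ip : V -> V -> C) (s w : nat -> V) (n : nat) (p : nat -> R)
  (f : V) (m : nat) (om : {ffun 'I_m -> nat}) : Prop :=
  let J := @wls_obj V ip s w n p f m om in
  Sigmahat ip s w n p om \in unitmx /\
  exists xt : 'cV[C]_n,
    (forall y, J xt <= J y) /\
    (forall x', (forall y, J x' <= J y) -> x' = xt) /\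
    hnorm ip (f - synth ip w (iota_n xt)) <=
      hnorm ip (projWnperp ip w n f) * Num.sqrt (1 + Kconst ip s w n p om ^+ 2).

Definition is_prob (p : nat -> R) :=
  (forall j, 0 <= p j) /\ (\sum_(j <oo) (p j)%:E = 1)%E.

Definition iid_prob (p : nat -> R) (m : nat) (E : set {ffun 'I_m -> nat}) : \bar R :=
  (\esum_(om in E) (\prod_(t < m) p (om t))%:E)%E.

End Defs.

(* Main.v *)
(* The empirical Gram matrix is singular exactly when the sampled vectors v_{i_t} fail to
   span C^n, so no matrix concentration inequality is needed. If L is the span of the
   vectors drawn so far and u_1, ..., u_d is an orthonormal basis of its complement, then
     d / |Sigma^-1| <= sum_l <Sigma u_l, u_l> = sum_j sum_l |<u_l, v_j>|^2
                    <= sum_(v_j notin L) |v_j|^2 <= R * P(v_j notin L),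
   hence each draw multiplies the expected codimension by at most 1 - 1 / (R |Sigma^-1|).
   After m draws the expected codimension, which bounds the probability of singularity,
   is at most n exp(- m / (R |Sigma^-1|)) <= delta.
   Once the empirical matrix is invertible, the normal equations give
   f - ftilde = g - T g with g the projection of f onto W_n^perp and T of norm K and range
   in W_n; Pythagoras concludes. *)
Require Import Defs.
From HB Require Import structures.
From mathcomp Require Import all_boot all_order all_algebra.
From mathcomp Require Import all_classical all_reals all_analysis.
From mathcomp Require Import complex zify ring lra.
Import Order.TTheory GRing.Theory Num.Theory numFieldNormedType.Exports.
Local Open Scope classical_set_scope.
Local Open Scope ring_scope.

Set Implicit Arguments.
Unset Strict Implicit.
Unset Printing Implicit Defensive.

(** * Product weights on finite sequences of draws *)

Section IndependentDraws.
Variables (R : realType) (p : nat -> R).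
Hypothesis p_ge0 : forall j, 0 <= p j.

Definition fcons m (j : nat) (om : {ffun 'I_m -> nat}) : {ffun 'I_m.+1 -> nat} :=
  [ffun t => if unlift ord0 t is Some t' then om t' else j].

Lemma fcons0 m j (om : {ffun 'I_m -> nat}) : fcons j om ord0 = j.
Proof. by rewrite ffunE unlift_none. Qed.

Lemma fconsS m j (om : {ffun 'I_m -> nat}) t : fcons j om (lift ord0 t) = om t.
Proof. by rewrite ffunE liftK. Qed.

(** Prepending a first draw is a bijection from pairs to sequences, so a nonnegative sum can be
    reindexed and iterated. *)
Lemma esum_fcons m (F : {ffun 'I_m.+1 -> nat} -> \bar R) :
  (forall om, 0 <= F om)%E ->
  (\esum_(om in [set: {ffun 'I_m.+1 -> nat}]) F om =
   \esum_(j in [set: nat]) \esum_(om in [set: {ffun 'I_m -> nat}]) F (fcons j om))%E.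
Proof.
move=> F0; rewrite (esum_esum (J := fun=> setT)); last by move=> *; exact: F0.
apply: (@reindex_esum _ _ _ _ _ (fun k => fcons k.1 k.2)); split => //.
  move=> [i x] [j y] _ _ /= /ffunP E; congr (_, _).
    by have := E ord0; rewrite !fcons0.
  by apply/ffunP => t; have := E (lift ord0 t); rewrite !fconsS.
move=> om _; exists (om ord0, [ffun t => om (lift ord0 t)]) => //=.
apply/ffunP => t; case: (unliftP ord0 t) => [t' ->|->].
  by rewrite fconsS ffunE.
by rewrite fcons0.
Qed.

(** Both inequalities compare finite subsums with a supremum; the second one divides by [a], so
    [a = 0] is set apart. *)
Lemma esumZl (T : choiceType) (I : set T) (a : R) (F : T -> \bar R) : 0 <= a ->
  (forall i, 0 <= F i)%E -> (\esum_(i in I) (a%:E * F i) = a%:E * \esum_(i in I) F i)%E.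
Proof.
move=> a0 F0; apply/eqP; rewrite eq_le; apply/andP; split.
  apply: ge_ereal_sup => _ [X [finX XI] <-].
  rewrite -ge0_mule_fsumr//.
  apply: lee_wpmul2l; first by rewrite lee_fin.
  by apply: ereal_sup_ubound; exists X.
have [->|an0] := eqVneq a 0.
  by rewrite mul0e; apply: esum_ge0 => i _; rewrite mul0e.
have ap : 0 < a by rewrite lt_def an0.
rewrite -lee_pdivlMl//; apply: ge_ereal_sup => _ [X [finX XI] <-].
rewrite lee_pdivlMl// ge0_mule_fsumr//.
by apply: ereal_sup_ubound; exists X.
Qed.

Lemma weight_ge0 m (om : {ffun 'I_m -> nat}) : 0 <= \prod_(t < m) p (om t).
Proof. by apply: prodr_ge0. Qed.

Lemma weight_fcons m j (om : {ffun 'I_m -> nat}) :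
  \prod_(t < m.+1) p (fcons j om t) = p j * \prod_(t < m) p (om t).
Proof.
by rewrite big_ord_recl fcons0; congr (_ * _); apply: eq_bigr => t _; rewrite fconsS.
Qed.

Lemma iid_prob_setT m : (\sum_(j <oo) (p j)%:E = 1)%E -> iid_prob p [set: {ffun 'I_m -> nat}] = 1%E.
Proof.
rewrite nneseries_esumT => [p1|j]; last by rewrite lee_fin.
elim: m => [|m IH].
  rewrite /iid_prob (_ : setT = [set [ffun=> 0%N]]).
    by rewrite esum_set1 big_ord0 // lee_fin.
  by apply/seteqP; split => // x _ /=; apply/ffunP => -[].
rewrite /iid_prob esum_fcons => [|om]; last by rewrite lee_fin weight_ge0.
rewrite -[RHS]p1; apply: eq_esum => j _.
rewrite (eq_esum (b := fun om : {ffun 'I_m -> nat} => (p j)%:E * (\prod_(t < m) p (om t))%:E)%E).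
  rewrite esumZl// => [|om]; last by rewrite lee_fin weight_ge0.
  by move: IH; rewrite /iid_prob => ->; rewrite mule1.
by move=> om _; rewrite weight_fcons EFinM.
Qed.

(* Coupon collecting, with the codimension of the span as potential. *)
Lemma codim_decay (F : fieldType) n (a : nat -> 'rV[F]_n) (c : R) :
  (forall L : 'M[F]_n,
    \esum_(j in [set: nat]) ((p j)%:E * (n - \rank (L + a j)%MS)%:R%:E)
      <= (expR (- c) * (n - \rank L)%:R)%:E)%E ->
  forall m (L : 'M[F]_n),
    (\esum_(om in [set: {ffun 'I_m -> nat}])
       ((\prod_(t < m) p (om t))%:E * (n - \rank (L + \sum_(t < m) <<a (om t)>>)%MS)%:R%:E)
      <= (expR (- (c * m%:R)) * (n - \rank L)%:R)%:E)%E.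
Proof.
(* The induction keeps [L] general: the first draw is absorbed into [L], and the remaining draws
   start from [L + a j]. *)
move=> step; elim => [|m IH] L.
  rewrite mulr0 oppr0 expR0 mul1r.
  rewrite (_ : setT = [set [ffun=> 0%N]]).
    rewrite esum_set1 ?big_ord0 ?mul1e ?addsmx0// mul1e lee_fin//.
  by apply/seteqP; split => // x _ /=; apply/ffunP => -[].
rewrite esum_fcons => [|om]; last by rewrite mule_ge0// lee_fin ?weight_ge0.
have -> : expR (- (c * m.+1%:R)) * (n - \rank L)%:R =
          expR (- (c * m%:R)) * (expR (- c) * (n - \rank L)%:R) :> R.
  by rewrite mulrA -expRD -opprD -natr1 mulrDr mulr1.
rewrite EFinM; apply: le_trans (lee_wpmul2l _ (step L)); last by rewrite lee_fin expR_ge0.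
rewrite -esumZl ?expR_ge0// => [|j]; last by rewrite mule_ge0// lee_fin.
apply: le_esum => j _; rewrite muleCA -EFinM.
rewrite (eq_esum (b := fun om : {ffun 'I_m -> nat} => (p j)%:E * ((\prod_(t < m) p (om t))%:E *
   (n - \rank ((L + a j) + \sum_(t < m) <<a (om t)>>)%MS)%:R%:E))%E); last first.
  move=> om _; rewrite weight_fcons EFinM muleA.
  congr (_ * _ * (_ - _)%:R%:E)%E.
  rewrite big_ord_recl fcons0; under eq_bigr do rewrite fconsS.
  rewrite addsmxA; apply: eqmx_rank; apply/eqmxP; apply: adds_eqmx; last exact: eqmx_refl.
  by apply: adds_eqmx; [exact: eqmx_refl|exact: genmxE].
rewrite esumZl => //; last by move=> om; rewrite mule_ge0// lee_fin weight_ge0.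
by rewrite EFinM lee_wpmul2l ?lee_fin.
Qed.
End IndependentDraws.

(** * Complex conjugation and squared modulus *)

Section ComplexFacts.
Variable R : realType.
Local Notation C := R[i].
Local Notation Re := (@complex.Re R).
Implicit Types x y z : C.

Lemma cconjE z : cconj z = z^*. Proof. by case: z. Qed.
Lemma ReD x y : Re (x + y) = Re x + Re y. Proof. by case: x; case: y. Qed.
Lemma ReB x y : Re (x - y) = Re x - Re y. Proof. by case: x; case: y. Qed.
Lemma Re_sum (I : Type) (r : seq I) (P : pred I) (F : I -> C) :
  Re (\sum_(i <- r | P i) F i) = \sum_(i <- r | P i) Re (F i).
Proof. by apply: (big_morph Re ReD). Qed.
Lemma Re_conj z : Re z^* = Re z. Proof. by case: z. Qed.
Lemma ReZl (a : R) z : Re (a%:C%C * z) = a * Re z.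
Proof. by case: z => u v /=; rewrite mul0r subr0. Qed.
Lemma mulJ_cmod2 z : z * z^* = (cmod2 z)%:C%C.
Proof. by case: z => u v; rewrite /cmod2 -cconjE /cconj; simpc; congr Complex => /=; ring. Qed.
Lemma cmod2_ge0 z : 0 <= cmod2 z.
Proof. by rewrite addr_ge0// sqr_ge0. Qed.
Lemma cmod2_eq0 z : cmod2 z = 0 -> z = 0.
Proof.
case: z => u v /eqP; rewrite /cmod2/= paddr_eq0 ?sqr_ge0// !sqrf_eq0.
by move=> /andP[/eqP-> /eqP->].
Qed.
Lemma cmod2_0 : cmod2 (0 : C) = 0.
Proof. by rewrite /cmod2/= expr0n/= addr0. Qed.
Lemma cmod2M x y : cmod2 (x * y) = cmod2 x * cmod2 y.
Proof. by case: x => a b; case: y => c d; rewrite /cmod2/=; ring. Qed.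
Lemma cmod2J z : cmod2 z^* = cmod2 z.
Proof. by rewrite -cconjE; case: z => u v; rewrite /cmod2 /= sqrrN. Qed.
Lemma cmod2N z : cmod2 (- z) = cmod2 z.
Proof. by case: z => u v; rewrite /cmod2 /= !sqrrN. Qed.
Lemma cmod2Re z : Re z ^+ 2 <= cmod2 z.
Proof. by rewrite lerDl sqr_ge0. Qed.
Lemma cmod2_real (a : R) : cmod2 a%:C%C = a ^+ 2.
Proof. by rewrite /cmod2/= expr0n addr0. Qed.
Lemma conj_real (a : R) : (a%:C%C : C)^* = a%:C%C.
Proof. by rewrite -cconjE /cconj/= oppr0. Qed.
Lemma conj_realM (a : R) z : (a%:C%C * z)^* = a%:C%C * z^*.
Proof. by rewrite rmorphM /= conj_real. Qed.
Lemma ReZlM (a : R) x y : Re (a%:C%C * x * y) = a * Re (x * y).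
Proof. by rewrite -mulrA ReZl. Qed.
End ComplexFacts.

(** * Orthonormal rows and orthogonal complements *)

Section OrthonormalRows.
Variable C : numClosedFieldType.
Local Open Scope sesquilinear_scope.

Lemma trmxC_mul m n k (A : 'M[C]_(m, n)) (B : 'M[C]_(n, k)) :
  (A *m B)^t* = B^t* *m A^t*.
Proof. by rewrite trmx_mul map_mxM. Qed.

Lemma sqnorm_mxE n (v : 'rV[C]_n) : (v *m v^t*) 0 0 = \sum_(i < n) v 0 i * (v 0 i)^*.
Proof. by rewrite mxE; apply: eq_bigr => i _; rewrite !mxE. Qed.

(** The row [b = v *m U^t*] lists the coefficients of [v] along the orthonormal rows of [U], and the
    residual [v - b *m U] has squared norm [|v|^2 - |b|^2]. *)
Lemma bessel_mx d n (U : 'M[C]_(d, n)) (v : 'rV[C]_n) :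
  U *m U^t* = 1%:M ->
  ((v *m U^t*) *m (v *m U^t*)^t*) 0 0 <= (v *m v^t*) 0 0.
Proof.
move=> U1; have [b bE] : exists b, b = v *m U^t* by eexists.
rewrite -bE.
have : 0 <= ((v - b *m U) *m (v - b *m U)^t*) 0 0.
  by rewrite sqnorm_mxE sumr_ge0// => i _; exact: mul_conjC_ge0.
suff -> : (v - b *m U) *m (v - b *m U)^t* = v *m v^t* - b *m b^t*.
  by rewrite mxE [X in _ + X]mxE subr_ge0.
have -> : (v - b *m U)^t* = v^t* - U^t* *m b^t*.
  by rewrite -trmxC_mul; apply/matrixP => i k; rewrite !mxE rmorphB.
rewrite mulmxBl !mulmxBr -!mulmxA (mulmxA U) U1 mul1mx.
have -> : v *m (U^t* *m b^t*) = b *m b^t* by rewrite mulmxA bE.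
have -> : U *m v^t* = b^t* by rewrite bE trmxC_mul trmxCK.
by rewrite subrr subr0.
Qed.

(** A row lies in the kernel of [L^t*] exactly when it is orthogonal to every row of [L];
    Gram-Schmidt is run on a basis of that kernel. *)
Lemma ortho_basis n (L : 'M[C]_n) :
  exists d (U : 'M[C]_(d, n)),
    [/\ d = (n - \rank L)%N, U *m U^t* = 1%:M & L *m U^t* = 0].
Proof.
pose K := kermx (L^t*).
exists (\rank K), (schmidt (row_base K)); split.
- by rewrite mxrank_ker mxrank_map mxrank_tr.
- by apply/unitarymxP/schmidt_unitarymx/rank_leq_col.
have : (schmidt (row_base K) <= K)%MS.
  by rewrite (eqmx_schmidt_free (row_base_free _)) eq_row_base.
set U := schmidt _; move=> /sub_kermxP UL.
have -> : L *m U^t* = (U *m L^t*)^t* by rewrite trmxC_mul trmxCK.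
by rewrite UL; apply/matrixP => i j; rewrite !mxE conjC0.
Qed.
End OrthonormalRows.

(** * Expected codimension after one draw *)

Section CodimensionStep.
Variable R : realType.
Local Notation C := R[i].
Local Notation Re := (@complex.Re R).
Local Open Scope sesquilinear_scope.

Definition rnorm2 n (v : 'rV[C]_n) : R := \sum_(i < n) cmod2 (v 0 i).

Lemma rnorm2E n (v : 'rV[C]_n) : (v *m v^t*) 0 0 = (rnorm2 v)%:C%C.
Proof.
by rewrite sqnorm_mxE rmorph_sum; apply: eq_bigr => i _; rewrite mulJ_cmod2.
Qed.

Lemma bessel d n (U : 'M[C]_(d, n)) (v : 'rV[C]_n) :
  U *m U^t* = 1%:M -> rnorm2 (v *m U^t*) <= rnorm2 v.
Proof. by move=> /(bessel_mx v); rewrite -lecR -!rnorm2E. Qed.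

Lemma rank_adds_row n (L : 'M[C]_n) (v : 'rV[C]_n) :
  (\rank L + ~~ (v <= L)%MS <= \rank (L + v)%MS)%N.
Proof.
have [vL|vL] := boolP (v <= L)%MS; first by rewrite addn0 mxrankS// addsmxSl.
rewrite addn1; apply: rank_ltmx; rewrite ltmxE addsmxSl/=.
by apply: contra vL; apply: submx_trans (addsmxSr _ _).
Qed.

(** The hypothesis with [e] and [N0] says [lam * |x|^2 <= sum_j |a_j x|^2] through partial sums.
    Summed over an orthonormal basis of the complement of [L], it bounds from below the probability
    that a draw leaves [L]. *)
Lemma expected_codim n (a : nat -> 'rV[C]_n) (p : nat -> R) (lam K : R) :
  (forall j, 0 <= p j) -> (\sum_(j <oo) (p j)%:E = 1)%E ->
  0 < K -> (forall j, rnorm2 (a j) <= K * p j) ->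
  (forall (x : 'cV[C]_n) (e : R), 0 < e -> exists N0, forall N, (N0 <= N)%N ->
     lam * rnorm2 (x^T) - e <= \sum_(j < N) cmod2 ((a j *m x) 0 0)) ->
  forall L : 'M[C]_n,
    (\esum_(j in [set: nat]) ((p j)%:E * (n - \rank (L + a j)%MS)%:R%:E)
      <= (expR (- (lam / K)) * (n - \rank L)%:R)%:E)%E.
Proof.
move=> p0 p1 K0 aK lamP L.
have [d [U [dE U1 LU]]] := ortho_basis L; rewrite -dE.
(* [q j] is 1 exactly when draw [j] enlarges the span, so the sum of [p j * q j] is the probability
   of progress. *)
pose q j : R := (~~ (a j <= L)%MS)%:R.
have pN N : \sum_(j < N) p j <= 1.
  rewrite -lee_fin -p1 -sumEFin -(big_mkord predT (fun j => (p j)%:E)).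
  by apply: nneseries_lim_ge => j _ _; rewrite lee_fin.
(* Rows inside [L] are orthogonal to [U] and contribute nothing; for the others Bessel's inequality
   applies. *)
have row_bound j : \sum_(l < d) cmod2 ((a j *m (U^t*)) 0 l) <= K * (p j * q j).
  rewrite /q; have [/submxP[D ->]|_] := boolP (a j <= L)%MS.
    rewrite -mulmxA LU mulmx0 !mulr0 big1// => l _; by rewrite mxE cmod2_0.
  by rewrite mulr1; apply: le_trans (aK j); exact: bessel.
have lower (e : R) : 0 < e -> exists N0, forall N, (N0 <= N)%N ->
    lam * d%:R - e <= K * \sum_(j < N) p j * q j.
  move=> e0.
  (* The tolerance [e] is shared equally among the [d] basis vectors; [f l] is the threshold of the
     vector [l], and the maximum of these serves all of them. *)
  have [f Pf] : exists f : 'I_d -> nat, forall l N, (f l <= N)%N ->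
      lam - e / d%:R <= \sum_(j < N) cmod2 ((a j *m U^t*) 0 l).
    have /fin_all_exists : forall l : 'I_d, exists N0, forall N, (N0 <= N)%N ->
      lam - e / d%:R <= \sum_(j < N) cmod2 ((a j *m U^t*) 0 l); last by [].
    move=> l.
    have d0 : 0 < d%:R :> R by rewrite ltr0n (leq_trans _ (ltn_ord l)).
    have [N0 PN] := lamP (col l (U^t*)) _ (divr_gt0 e0 d0).
    exists N0 => N /PN; rewrite (_ : rnorm2 _ = 1) ?mulr1.
      move=> /le_trans; apply; apply: ler_sum => j _.
      rewrite !mxE; under eq_bigr do rewrite !mxE.
      by under [X in _ <= cmod2 X]eq_bigr do rewrite !mxE.
    move/matrixP: U1 => /(_ l l); rewrite !mxE eqxx => E.
    have [] : (rnorm2 (col l (U^t*))^T)%:C%C = 1%:C%C :> C; last by [].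
    rewrite -[RHS]E rmorph_sum; apply: eq_bigr => i _ /=.
    by rewrite !mxE cmod2J mulJ_cmod2.
  exists (\max_l f l) => N HN.
  have [->|dn0] := eqVneq d 0%N.
    rewrite mulr0 sub0r; apply: (@le_trans _ _ 0); first by rewrite oppr_le0 ltW.
    by rewrite mulr_ge0 ?(ltW K0)// sumr_ge0// => j _; rewrite mulr_ge0.
  rewrite mulr_sumr (le_trans _ (ler_sum _ (fun j _ => row_bound _)))//.
  rewrite exchange_big/=.
  have -> : lam * d%:R - e = \sum_(l < d) (lam - e / d%:R).
    by rewrite sumr_const card_ord -[RHS]mulr_natr mulrBl divfK// pnatr_eq0.
  by apply: ler_sum => l _; apply: Pf; apply: leq_trans HN; exact: leq_bigmax.
have term_le j : p j * (n - \rank (L + a j)%MS)%:R <= p j * d%:R - p j * q j.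
  rewrite -mulrBr ler_wpM2l// lerBrDr -natrD ler_nat dE.
  have := rank_adds_row L (a j); have := rank_leq_col (L + a j)%MS.
  by move: (\rank L) (\rank (L + a j)%MS) => r1 r2; case: (~~ _) => /=; lia.
rewrite -nneseries_esumT => [|j]; last by rewrite mule_ge0// lee_fin.
apply: lime_le; first by apply: is_cvg_nneseries => j _ _; rewrite mule_ge0// lee_fin.
apply: nearW => N; rewrite big_mkord; under eq_bigr do rewrite -EFinM.
rewrite sumEFin lee_fin.
(* The exponential enters only through [1 + x <= expR x], at [x = - (lam / K)]. *)
apply: (@le_trans _ _ ((1 - lam / K) * d%:R)); last first.
  by rewrite ler_wpM2r// expR_ge1Dx.
apply/ler_addgt0Pr => e e0.
have [N0 PN] := lower _ (mulr_gt0 K0 e0).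
(* Passing from [N] to [N'] only adds nonnegative terms, and reaches the range where the lower bound
   on progress holds. *)
pose N' := maxn N N0.
apply: (@le_trans _ _ (\sum_(j < N') p j * (n - \rank (L + a j)%MS)%:R)).
  rewrite -!(big_mkord predT (fun j => p j * (n - \rank (L + a j)%MS)%:R)).
  rewrite (@big_cat_nat _ _ _ N 0 N')//= ?leq_maxl// lerDl sumr_ge0// => j _.
  by rewrite mulr_ge0.
apply: le_trans (ler_sum _ (fun j _ => term_le _)) _.
rewrite sumrB -mulr_suml.
have := PN N' (leq_maxr _ _); set S := \sum_(i < N') p i * q i => HS.
have {}HS : lam / K * d%:R - e <= S.
  rewrite -(ler_pM2l K0) (le_trans _ HS)// le_eqVlt; apply/orP; left; apply/eqP.
  by field; rewrite gt_eqF.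
have : (\sum_(i < N') p i) * d%:R <= d%:R by rewrite ler_piMl.
lra.
Qed.
End CodimensionStep.

Lemma unitmx_ker (F : fieldType) n (M : 'M[F]_n) :
  (forall x : 'cV[F]_n, M *m x = 0 -> x = 0) -> M \in unitmx.
Proof.
move=> Mx; rewrite -unitmx_tr unitmxE unitfE; apply/negP => /det0P[v v0 vM].
move/negP: v0; apply; rewrite -[v]trmxK; apply/eqP.
by rewrite (Mx v^T) ?trmx0// -[M]trmxK -trmx_mul vM trmx0.
Qed.

(** * Semi-inner products, covering both [ip] and the product [dotc] of column vectors *)

Section SemiInnerProduct.
Variable R : realType.
Local Notation C := R[i].
Local Notation Re := (@complex.Re R).
Variables (V : lmodType C) (ip : V -> V -> C).
Hypothesis linl : forall (a : C) x y z, ip (a *: x + y) z = a * ip x z + ip y z.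
Hypothesis sym : forall x y, ip y x = cconj (ip x y).
Hypothesis pos : forall x, 0 <= Re (ip x x).
Local Notation hnorm := (hnorm ip).

Lemma ip0l z : ip 0 z = 0.
Proof. by have := linl (-1) 0 0 z; rewrite scaler0 addr0 mulN1r addNr. Qed.
Lemma ipDl x y z : ip (x + y) z = ip x z + ip y z.
Proof. by have := linl 1 x y z; rewrite scale1r mul1r. Qed.
Lemma ipZl a x z : ip (a *: x) z = a * ip x z.
Proof. by have := linl a x 0 z; rewrite addr0 ip0l addr0. Qed.
Lemma ipNl x z : ip (- x) z = - ip x z.
Proof. by rewrite -scaleN1r ipZl mulN1r. Qed.
Lemma ipBl x y z : ip (x - y) z = ip x z - ip y z.
Proof. by rewrite ipDl ipNl. Qed.
Lemma ip_suml (I : Type) (r : seq I) (P : pred I) (F : I -> V) z :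
  ip (\sum_(i <- r | P i) F i) z = \sum_(i <- r | P i) ip (F i) z.
Proof. by apply: (big_morph (ip^~ z)) => [x y|]; [exact: ipDl|exact: ip0l]. Qed.

Lemma ipC x y : ip y x = (ip x y)^*. Proof. by rewrite sym cconjE. Qed.
Lemma ip0r z : ip z 0 = 0. Proof. by rewrite ipC ip0l conjC0. Qed.
Lemma ipDr x y z : ip z (x + y) = ip z x + ip z y.
Proof. by rewrite ipC ipDl rmorphD (ipC x z) (ipC y z). Qed.
Lemma ipZr a x z : ip z (a *: x) = a^* * ip z x.
Proof. by rewrite ipC ipZl rmorphM (ipC x z). Qed.
Lemma ipNr x z : ip z (- x) = - ip z x.
Proof. by rewrite ipC ipNl rmorphN (ipC x z). Qed.
Lemma ipBr x y z : ip z (x - y) = ip z x - ip z y.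
Proof. by rewrite ipDr ipNr. Qed.
Lemma ip_sumr (I : Type) (r : seq I) (P : pred I) (F : I -> V) z :
  ip z (\sum_(i <- r | P i) F i) = \sum_(i <- r | P i) ip z (F i).
Proof. by apply: (big_morph (ip z)) => [x y|]; [exact: ipDr|exact: ip0r]. Qed.

Lemma hnorm_ge0 x : 0 <= hnorm x. Proof. exact: sqrtr_ge0. Qed.
Lemma hnorm_sq x : hnorm x ^+ 2 = Re (ip x x).
Proof. by rewrite sqr_sqrtr. Qed.
Lemma ip_xx x : ip x x = (hnorm x ^+ 2)%:C%C.
Proof.
rewrite hnorm_sq; have := sym x x; case: (ip x x) => u v [] /= vE; congr Complex.
by lra.
Qed.
Lemma hnorm0 : hnorm 0 = 0.
Proof. by rewrite /Defs.hnorm ip0l sqrtr0. Qed.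

Lemma hnormB_sq x y :
  hnorm (x - y) ^+ 2 = hnorm x ^+ 2 - 2 * Re (ip x y) + hnorm y ^+ 2.
Proof.
rewrite !hnorm_sq ipBl !ipBr !ReB (ipC x y) Re_conj; ring.
Qed.

Lemma hnormD_sq x y :
  hnorm (x + y) ^+ 2 = hnorm x ^+ 2 + 2 * Re (ip x y) + hnorm y ^+ 2.
Proof.
rewrite !hnorm_sq ipDl !ipDr !ReD (ipC x y) Re_conj; ring.
Qed.

Lemma hnormZ_sq a x : hnorm (a *: x) ^+ 2 = cmod2 a * hnorm x ^+ 2.
Proof. by rewrite !hnorm_sq ipZl ipZr mulrA mulJ_cmod2 ReZl. Qed.

Lemma hnormZ a x : hnorm (a *: x) = Num.sqrt (cmod2 a) * hnorm x.
Proof.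
by rewrite /Defs.hnorm -!hnorm_sq hnormZ_sq sqrtrM// cmod2_ge0.
Qed.

Lemma hnormZr (a : R) x : 0 <= a -> hnorm (a%:C%C *: x) = a * hnorm x.
Proof. by move=> a0; rewrite hnormZ cmod2_real sqrtr_sqr ger0_norm. Qed.

Lemma hnormN x : hnorm (- x) = hnorm x.
Proof. by rewrite /Defs.hnorm ipNl ipNr opprK. Qed.

(** Expand [|b x - y|^2 >= 0] and divide by [b]. *)
Lemma young x y (b : R) : 0 < b ->
  2 * Re (ip x y) <= b * hnorm x ^+ 2 + b^-1 * hnorm y ^+ 2.
Proof.
move=> b0; have := sqr_ge0 (hnorm (b%:C%C *: x - y)).
rewrite hnormB_sq hnormZ_sq cmod2_real ipZl ReZl => H.
rewrite -(ler_pM2l b0) mulrDr !mulrA divff ?gt_eqF// mul1r.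
by move: H; rewrite expr2 [_ * (2 : R)]mulrC mulrA; lra.
Qed.

Lemma cauchy_schwarz x y : cmod2 (ip x y) <= hnorm x ^+ 2 * hnorm y ^+ 2.
Proof.
set k := cmod2 _; set X := hnorm x ^+ 2; set Y := hnorm y ^+ 2.
have X0 : 0 <= X by exact: sqr_ge0.
have Y0 : 0 <= Y by exact: sqr_ge0.
have k0 : 0 <= k by exact: cmod2_ge0.
(* This is the squared norm of [x - t <x,y> y], a polynomial in [t]. *)
have key (t : R) : 0 <= X - 2 * t * k + t ^+ 2 * k * Y.
  have := sqr_ge0 (hnorm (x - (t%:C%C * ip x y) *: y)).
  rewrite hnormB_sq hnormZ_sq cmod2M cmod2_real ipZr conj_realM -[_ * ip x y]mulrA.
  by rewrite (mulrC _ (ip x y)) mulJ_cmod2 ReZl /= -/k -/X -/Y mulrA.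
have [Y00|Yn0] := eqVneq Y 0.
  rewrite Y00 mulr0; have [->//|kn0] := eqVneq k 0.
  (* With [Y = 0] the polynomial is affine in [t], and this [t] would give it the value -1. *)
  have := key ((X + 1) / (2 * k)); rewrite Y00 mulr0 addr0.
  have -> : 2 * ((X + 1) / (2 * k)) * k = X + 1 by field.
  lra.
have := key Y^-1.
have -> : X - 2 * Y^-1 * k + Y^-1 ^+ 2 * k * Y = X - k / Y by field.
by rewrite subr_ge0 ler_pdivrMr// lt_def Yn0.
Qed.

Lemma cs_norm x y : Num.sqrt (cmod2 (ip x y)) <= hnorm x * hnorm y.
Proof.
rewrite -(@ler_sqr _ (Num.sqrt _)) ?nnegrE ?sqrtr_ge0 ?mulr_ge0 ?hnorm_ge0//.
by rewrite sqr_sqrtr ?cmod2_ge0// exprMn cauchy_schwarz.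
Qed.

Lemma Re_cs x y : Re (ip x y) <= hnorm x * hnorm y.
Proof.
apply: le_trans (cs_norm x y); apply: le_trans (ler_norm _) _.
by rewrite -sqrtr_sqr ler_wsqrtr// cmod2Re.
Qed.

Lemma hnormD x y : hnorm (x + y) <= hnorm x + hnorm y.
Proof.
rewrite -(@ler_sqr _ (hnorm _)) ?nnegrE ?addr_ge0 ?hnorm_ge0// hnormD_sq.
have := Re_cs x y; move: (Re _) (hnorm _) (hnorm _) => *; nra.
Qed.

Lemma hnorm_sum (I : Type) (r : seq I) (P : pred I) (F : I -> V) :
  hnorm (\sum_(i <- r | P i) F i) <= \sum_(i <- r | P i) hnorm (F i).
Proof.
elim/big_ind2 : _ => //; first by rewrite hnorm0.
by move=> x a y b xa yb; apply: le_trans (hnormD _ _) (lerD xa yb).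
Qed.
End SemiInnerProduct.

(* The suprema in [mxopnorm] and [hopnorm] are junk unless the set is bounded. *)
Lemma le_opnorm (R : realType) (V W : lmodType R[i]) (N : V -> R) (N' : W -> R)
    (T : V -> W) (M : R) :
  (forall (a : R) x, 0 <= a -> N (a%:C%C *: x) = a * N x) ->
  (forall (a : R) x, 0 <= a -> N' (a%:C%C *: x) = a * N' x) ->
  (forall (a : R) x, T (a%:C%C *: x) = a%:C%C *: T x) ->
  (forall x, 0 <= N x) -> 0 <= M -> (forall x, N' (T x) <= M * N x) ->
  forall x, N' (T x) <= sup [set N' (T h) | h in [set h | N h <= 1]] * N x.
Proof.
move=> NZ N'Z TZ N0 M0 TM x.
set S := [set _ | _ in _].
have ubS : has_ubound S.
  by exists M => _ [h /= h1 <-]; apply: le_trans (TM h) _; rewrite ler_piMr.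
have [x0|xn0] := eqVneq (N x) 0; first by have := TM x; rewrite x0 !mulr0.
have xp : 0 < N x by rewrite lt_def xn0 N0.
rewrite -ler_pdivrMr// mulrC -N'Z ?invr_ge0// -TZ; apply: ub_le_sup => //.
by exists ((N x)^-1%:C%C *: x) => //=; rewrite NZ ?invr_ge0// mulVf.
Qed.

(** * Operator norm of matrices and coercivity of positive forms *)

Section MatrixNorm.
Variable R : realType.
Local Notation C := R[i].
Local Notation Re := (@complex.Re R).
Variable n : nat.
Local Open Scope sesquilinear_scope.
Implicit Types (x y : 'cV[C]_n) (M : 'M[C]_n).

Definition dotc x y : C := (y^t* *m x) 0 0.

Lemma dotcE x y : dotc x y = \sum_(i < n) x i 0 * (y i 0)^*.
Proof. by rewrite /dotc mxE; apply: eq_bigr => i _; rewrite !mxE mulrC. Qed.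

Lemma dotc_linl (a : C) x y z : dotc (a *: x + y) z = a * dotc x z + dotc y z.
Proof. by rewrite /dotc mulmxDr -scalemxAr !mxE. Qed.

Lemma dotc_sym x y : dotc y x = cconj (dotc x y).
Proof.
rewrite cconjE !dotcE rmorph_sum; apply: eq_bigr => i _ /=.
by rewrite rmorphM /= conjCK mulrC.
Qed.

Lemma dotc_xx x : Re (dotc x x) = \sum_(i < n) cmod2 (x i 0).
Proof. by rewrite dotcE Re_sum; apply: eq_bigr => i _; rewrite mulJ_cmod2. Qed.

Lemma dotc_pos x : 0 <= Re (dotc x x).
Proof. by rewrite dotc_xx sumr_ge0// => i _; exact: cmod2_ge0. Qed.

Lemma vnormE x : vnorm x = hnorm dotc x.
Proof. by rewrite /hnorm dotc_xx. Qed.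

Lemma vnorm_ge0 x : 0 <= vnorm x. Proof. exact: sqrtr_ge0. Qed.

Lemma vnorm_sq x : vnorm x ^+ 2 = \sum_(i < n) cmod2 (x i 0).
Proof. by rewrite sqr_sqrtr// sumr_ge0// => i _; exact: cmod2_ge0. Qed.

Lemma vnormZr (a : R) x : 0 <= a -> vnorm (a%:C%C *: x) = a * vnorm x.
Proof.
by rewrite !vnormE; apply: hnormZr; [exact: dotc_linl|exact: dotc_sym|exact: dotc_pos].
Qed.

Lemma vnorm_eq0 x : vnorm x = 0 -> x = 0.
Proof.
move=> x0; have /eqP : \sum_(i < n) cmod2 (x i 0) = 0 by rewrite -vnorm_sq x0 expr0n.
rewrite psumr_eq0 => [/allP x0'|i _]; last exact: cmod2_ge0.
apply/matrixP => i j; rewrite ord1 mxE; apply: cmod2_eq0; apply/eqP.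
by apply: x0'; rewrite mem_index_enum.
Qed.

(** Cauchy-Schwarz row by row: the witness is the Frobenius norm of [M]. *)
Lemma vnorm_mulmx_bounded M : exists2 K : R, 0 <= K & forall x, vnorm (M *m x) <= K * vnorm x.
Proof.
pose r (i : 'I_n) : 'cV[C]_n := \col_j (M i j)^*.
pose K2 := \sum_(i < n) vnorm (r i) ^+ 2.
have K20 : 0 <= K2 by apply: sumr_ge0 => i _; exact: sqr_ge0.
exists (Num.sqrt K2); first exact: sqrtr_ge0.
move=> x; rewrite -(@ler_sqr _ (vnorm _)) ?nnegrE ?vnorm_ge0 ?mulr_ge0 ?sqrtr_ge0 ?vnorm_ge0//.
rewrite exprMn (sqr_sqrtr K20) vnorm_sq mulr_suml; apply: ler_sum => i _.
have -> : (M *m x) i 0 = dotc x (r i).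
  by rewrite dotcE mxE; apply: eq_bigr => j _; rewrite mxE conjCK mulrC.
rewrite mulrC !vnormE.
by apply: cauchy_schwarz; [exact: dotc_linl|exact: dotc_sym|exact: dotc_pos].
Qed.

Lemma le_mxopnorm M x : vnorm (M *m x) <= mxopnorm M * vnorm x.
Proof.
have [K K0 MK] := vnorm_mulmx_bounded M.
apply: (le_opnorm (N' := @vnorm R n)) K0 MK _ => //.
- by move=> a y; exact: vnormZr.
- by move=> a y; exact: vnormZr.
- by move=> a y; rewrite -scalemxAr.
- exact: vnorm_ge0.
Qed.

Lemma mxopnorm_ge0 M : 0 <= mxopnorm M.
Proof.
have [K K0 MK] := vnorm_mulmx_bounded M.
apply: le_trans (vnorm_ge0 (M *m 0)) _; apply: ub_le_sup.
  by exists K => _ [h /= h1 <-]; apply: le_trans (MK h) _; rewrite ler_piMr.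
by exists 0 => //=; rewrite vnormE (hnorm0 dotc_linl) ler01.
Qed.

(** Both norm bounds are applied to [x = M (M^-1 x)] at a basis vector [x], which exists because
    [0 < n]. *)
Lemma mxopnorm_mul_inv M : (0 < n)%N -> M \in unitmx ->
  1 <= mxopnorm M * mxopnorm (invmx M).
Proof.
move=> n0 Mu; pose x : 'cV[C]_n := delta_mx (Ordinal n0) 0.
have x0 : 0 < vnorm x.
  rewrite lt_def vnorm_ge0 andbT; apply/eqP => /vnorm_eq0/matrixP/(_ (Ordinal n0) 0).
  by rewrite !mxE !eqxx => /eqP; rewrite oner_eq0.
rewrite -(ler_pM2r x0) mul1r -{1}(mulKVmx Mu x) -mulrA.
apply: le_trans (le_mxopnorm _ _) _.
by rewrite ler_wpM2l ?mxopnorm_ge0// le_mxopnorm.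
Qed.

Lemma mxopnorm_inv_gt0 M : (0 < n)%N -> M \in unitmx -> 0 < mxopnorm (invmx M).
Proof.
move=> n0 Mu; rewrite lt_def mxopnorm_ge0 andbT; apply/eqP => E.
by have := mxopnorm_mul_inv n0 Mu; rewrite E mulr0 ler10.
Qed.

(* Expand the form at [k x - Sig^-1 x], [k] the norm of [Sig^-1]. *)
Lemma coercive M : (0 < n)%N -> M^t* = M -> M \in unitmx ->
  (forall x, 0 <= Re (dotc (M *m x) x)) ->
  forall x, (mxopnorm (invmx M))^-1 * vnorm x ^+ 2 <= Re (dotc (M *m x) x).
Proof.
move=> n0 Mh Mu Mpos x; set k := mxopnorm _.
have k0 : 0 < k by exact: mxopnorm_inv_gt0.
pose y := invmx M *m x.
have Myx : M *m y = x by rewrite mulKVmx.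
have hM u v : dotc (M *m u) v = dotc u (M *m v).
  by rewrite /dotc mulmxA trmx_mul map_mxM Mh.
have l := dotc_linl; have s := dotc_sym; have p := dotc_pos.
have := Mpos (k%:C%C *: x - y).
rewrite mulmxBr -scalemxAr Myx !(ipBl l, ipBr l s, ipZl l, ipZr l s).
rewrite (hM x y) Myx conj_real !ReB !ReZl.
have -> : Re (dotc x x) = vnorm x ^+ 2 by rewrite dotc_xx vnorm_sq.
have : Re (dotc x y) <= k * vnorm x ^+ 2.
  apply: le_trans (Re_cs l s p _ _) _; rewrite -!vnormE.
  rewrite mulrC expr2 mulrA ler_wpM2r ?vnorm_ge0//; exact: le_mxopnorm.
(* The expansion reads [k^2 a - 2 k c + b >= 0]; with [b <= k c] it leaves [k a >= c]. *)
move: (Re (dotc (M *m x) x)) (Re _) (vnorm x ^+ 2) => a b c.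
move=> bc H; rewrite -(ler_pM2l k0) mulVKf ?gt_eqF//.
by rewrite -(ler_pM2l k0); lra.
Qed.
End MatrixNorm.

Lemma sum_stationary (V : zmodType) (u : nat -> V) N k :
  (forall j, (N <= j)%N -> u j = 0) -> (N <= k)%N -> \sum_(j < k) u j = \sum_(j < N) u j.
Proof.
move=> u0 Nk; rewrite -(big_mkord predT u) (@big_cat_nat _ _ _ N 0 k)//= big_mkord.
rewrite -[RHS]addr0; congr (_ + _); rewrite big_nat_cond big1// => i.
by rewrite andbT => /andP[Ni _]; exact: u0.
Qed.

(** * Convergence of complex series *)

Section ComplexSeries.
Variable R : realType.
Local Notation C := R[i].
Local Notation Re := (@complex.Re R).
Local Notation Im := (@complex.Im R).
Implicit Types (u v : nat -> C) (l x z : C).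

(** Splitting into real and imaginary parts gives access to the limit theory of real sequences;
    [cvg_series_csum] leads back to [csum]. *)
Definition cvg_series u l :=
  ((\sum_(k < N) Re (u k)) @[N --> \oo] --> Re l) /\
  ((\sum_(k < N) Im (u k)) @[N --> \oo] --> Im l).

Lemma ImD x z : Im (x + z) = Im x + Im z. Proof. by case: x; case: z. Qed.
Lemma ReM x z : Re (x * z) = Re x * Re z - Im x * Im z.
Proof. by case: x; case: z. Qed.
Lemma ImM x z : Im (x * z) = Re x * Im z + Im x * Re z.
Proof. by case: x; case: z. Qed.

Lemma Im_sum (I : Type) (r : seq I) (P : pred I) (F : I -> C) :
  Im (\sum_(i <- r | P i) F i) = \sum_(i <- r | P i) Im (F i).
Proof. by apply: (big_morph Im ImD). Qed.

Lemma cmod2D_le x z : cmod2 (x + z) <= 2 * (cmod2 x + cmod2 z).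
Proof.
case: x => a b; case: z => c d; rewrite /cmod2/=.
have := sqr_ge0 (a - c); have := sqr_ge0 (b - d); nra.
Qed.

Lemma cconv_unique u l z : cconv u l -> cconv u z -> l = z.
Proof.
move=> ul uz; apply/eqP; rewrite -subr_eq0; apply/eqP/cmod2_eq0/eqP.
apply/negPn/negP => n0.
have d0 : 0 < cmod2 (l - z) by rewrite lt_def n0 cmod2_ge0.
(* By [cmod2D_le], two squared distances below [e ^+ 2] would force [cmod2 (l - z)] below itself. *)
pose e := Num.sqrt (cmod2 (l - z) / 4).
have e0 : 0 < e by rewrite sqrtr_gt0 divr_gt0.
have [N3 H3] := ul e e0; have [N2 H2] := uz e e0.
have := H3 _ (leq_maxl N3 N2); have := H2 _ (leq_maxr N3 N2).
set S := \sum_(j < _) _ => A B; have := cmod2D_le (S - z) (- (S - l)).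
rewrite cmod2N opprB addrC addrA subrK => D.
by move: A B; rewrite sqr_sqrtr ?divr_ge0 ?cmod2_ge0// => *; lra.
Qed.

Lemma csum_eq u l : cconv u l -> csum u = l.
Proof. by move=> ul; apply: xget_unique => // y uy; exact: cconv_unique uy ul. Qed.

Lemma cvg_series_csum u l : cvg_series u l -> csum u = l.
Proof.
move=> [/cvgrPdist_lt HR /cvgrPdist_lt HI]; apply: csum_eq => e e0.
have e2 : 0 < e / 2 by rewrite divr_gt0.
have [N1 _ P1] := HR _ e2; have [N2 _ P2] := HI _ e2.
exists (maxn N1 N2) => k; rewrite geq_max => /andP[k1 k2].
have := P1 k k1; have := P2 k k2; rewrite -Re_sum -Im_sum /=.
move: (\sum_(i < k) u i) => [a b]; case: (l) => c d; rewrite /cmod2/=.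
rewrite !ltr_norml => /andP[? ?] /andP[? ?]; nra.
Qed.

Lemma csum_finite u N : (forall k, (N <= k)%N -> u k = 0) -> csum u = \sum_(k < N) u k.
Proof.
move=> u0; apply: csum_eq => e e0; exists N => k Nk.
by rewrite (sum_stationary u0 Nk) subrr cmod2_0 exprn_gt0.
Qed.

Lemma cvg_seriesD u v l z :
  cvg_series u l -> cvg_series v z -> cvg_series (fun k => u k + v k) (l + z).
Proof.
move=> [uR uI] [vR vI]; split.
  rewrite ReD; under eq_fun do under eq_bigr do rewrite ReD.
  under eq_fun do rewrite big_split; exact: cvgD.
rewrite ImD; under eq_fun do under eq_bigr do rewrite ImD.
under eq_fun do rewrite big_split; exact: cvgD.
Qed.

Lemma cvg_seriesZ c u l : cvg_series u l -> cvg_series (fun k => c * u k) (c * l).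
Proof.
move=> [HR HI]; split.
  rewrite ReM; under eq_fun do under eq_bigr do rewrite ReM.
  under eq_fun do rewrite sumrB -!mulr_sumr.
  by apply: cvgB; exact: cvgMl_tmp.
rewrite ImM; under eq_fun do under eq_bigr do rewrite ImM.
under eq_fun do rewrite big_split -!mulr_sumr.
by apply: cvgD; exact: cvgMl_tmp.
Qed.

Lemma cvg_series_conj u l : cvg_series u l -> cvg_series (fun k => (u k)^*) l^*.
Proof.
move=> [uR uI]; split.
  by rewrite Re_conj; under eq_fun do under eq_bigr do rewrite Re_conj.
have ImJ z : complex.Im z^* = - Im z by rewrite -cconjE; case: z.
rewrite ImJ; under eq_fun do under eq_bigr do rewrite ImJ.
under eq_fun do rewrite sumrN.
exact: cvgN.
Qed.

Lemma cvg_series0 : cvg_series (fun=> 0) 0.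
Proof.
by split; under eq_fun do rewrite big1//; exact: cvg_cst.
Qed.

Lemma cvg_series_sum n (u : 'I_n -> nat -> C) (l : 'I_n -> C) :
  (forall i, cvg_series (u i) (l i)) ->
  cvg_series (fun k => \sum_(i < n) u i k) (\sum_(i < n) l i).
Proof.
elim: n u l => [|n IH] u l ul.
  by rewrite big_ord0; under [X in cvg_series X]eq_fun do rewrite big_ord0; exact: cvg_series0.
rewrite big_ord_recr; under [X in cvg_series X]eq_fun do rewrite big_ord_recr.
by apply: cvg_seriesD => //; apply: IH.
Qed.

Lemma real_series_cvg (f g : nat -> R) (M : R) : (forall k, `|f k| <= g k) ->
  (forall N, \sum_(k < N) g k <= M) ->
  exists a : R, (\sum_(k < N) f k) @[N --> \oo] --> a.
Proof.
move=> fg gM.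
have f0 k : 0 <= g k by apply: le_trans (fg k).
have cg : cvgn (series g).
  apply: nondecreasing_is_cvgn; first exact: nondecreasing_series.
  by exists M => _ [N _ <-]; rewrite /series/= big_mkord.
have cf : cvgn (series f).
  by apply: normed_cvg; exact: (series_le_cvg (fun k => normr_ge0 (f k)) f0 fg cg).
have E : series f = (fun N => \sum_(k < N) f k).
  by apply/funext => N; rewrite /series/= big_mkord.
by rewrite E in cf; exists (limn (fun N => \sum_(k < N) f k)).
Qed.

(** The real and imaginary parts of each product are dominated by [|u_k|^2 + |v_k|^2], so both
    series converge absolutely. *)
Lemma cvg_series_prod u v (M : R) :
  (forall N, \sum_(k < N) cmod2 (u k) <= M) ->
  (forall N, \sum_(k < N) cmod2 (v k) <= M) ->
  exists l, cvg_series (fun k => u k * (v k)^*) l.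
Proof.
move=> uM vM; pose g k := cmod2 (u k) + cmod2 (v k).
have gM N : \sum_(k < N) g k <= M + M by rewrite big_split lerD.
have bd k : (`|Re (u k * (v k)^*)| <= g k) /\ (`|Im (u k * (v k)^*)| <= g k).
  rewrite /g -cconjE; case: (u k) => a b; case: (v k) => c d; rewrite /cmod2 /cconj/=.
  have := sqr_ge0 (a - c); have := sqr_ge0 (b - d); have := sqr_ge0 (a + c).
  have := sqr_ge0 (b + d); have := sqr_ge0 (a - d); have := sqr_ge0 (b - c).
  have := sqr_ge0 (a + d); have := sqr_ge0 (b + c).
  have := sqr_ge0 a; have := sqr_ge0 b; have := sqr_ge0 c; have := sqr_ge0 d.
  by rewrite !ler_norml => *; split; apply/andP; split; lra.
have [l1 H1] := real_series_cvg (fun k => (bd k).1) gM.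
have [l2 H2] := real_series_cvg (fun k => (bd k).2) gM.
by exists (Complex l1 l2).
Qed.

End ComplexSeries.

(** * Synthesis operators, closed spans and the Bessel bound *)

Section FrameOperators.
Variables (R : realType) (V : lmodType R[i]) (ip : V -> V -> R[i]).
Hypothesis HV : is_hilbert ip.
Local Notation C := R[i].
Local Notation Re := (@complex.Re R).
Local Notation hnorm := (hnorm ip).
Local Notation linl := (ip_linl HV).
Local Notation sym := (ip_sym HV).
Local Notation pos := (ip_pos HV).

Lemma hnorm_eq0 x : hnorm x = 0 -> x = 0.
Proof. by move=> x0; apply: (ip_def HV); rewrite (ip_xx sym pos) x0 expr0n. Qed.

Lemma hconv_unique u l l' : hconv ip u l -> hconv ip u l' -> l = l'.
Proof.
move=> ul ul'; apply/eqP; rewrite -subr_eq0; apply/eqP/hnorm_eq0/eqP.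
rewrite eq_le (hnorm_ge0 ip) andbT; apply/ler_addgt0Pr => e e0; rewrite add0r.
have e2 : 0 < e / 2 by rewrite divr_gt0.
have [N HN] := ul _ e2; have [N' HN'] := ul' _ e2.
have := HN _ (leq_maxl N N'); have := HN' _ (leq_maxr N N').
set a := u _; have := hnormD linl sym pos (a - l') (- (a - l)).
rewrite (hnormN linl sym) opprB addrC addrA subrK => *; lra.
Qed.

(** [synth] picks a limit by [xget]; uniqueness of limits identifies the pick. *)
Lemma synth_eq w x l N : (forall k, (N <= k)%N -> psum w x k = l) -> synth ip w x = l.
Proof.
move=> Hl; have cl : hconv ip (psum w x) l.
  by move=> e e0; exists N => k /Hl ->; rewrite subrr (hnorm0 linl).
by apply: xget_unique => // y; move/hconv_unique; apply.
Qed.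

Lemma synth_finite w x N : (forall j, (N <= j)%N -> x j = 0) ->
  synth ip w x = \sum_(k < N) x k *: w k.
Proof.
move=> x0; apply: (synth_eq (N := N)) => k Nk; rewrite /psum.
by apply: (sum_stationary (u := fun k => x k *: w k)) => // j /x0 ->; rewrite scale0r.
Qed.

Lemma synth_ebasis s j : synth ip s (ebasis R j) = s j.
Proof.
rewrite (@synth_finite _ _ j.+1) => [|k jk]; last by rewrite /ebasis gtn_eqF.
rewrite big_ord_recr/= /ebasis eqxx scale1r big1 ?add0r// => i _.
by rewrite ltn_eqF ?scale0r.
Qed.

Lemma in_cspan_sum s N (c : nat -> C) : in_cspan ip s (\sum_(k < N) c k *: s k).
Proof. by move=> e e0; exists N, c; rewrite subrr (hnorm0 linl). Qed.

(** Subtracting from [g] a finite combination of the [s k] does not change [ip h g], and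
    Cauchy-Schwarz makes the rest arbitrarily small. *)
Lemma in_cspan_perpP s h : (forall k, ip h (s k) = 0) -> in_cspan_perp ip s h.
Proof.
move=> hs g gs; apply: cmod2_eq0; apply/eqP; rewrite eq_le cmod2_ge0 andbT.
have key (e : R) : 0 < e -> cmod2 (ip h g) <= hnorm h ^+ 2 * e ^+ 2.
  move=> e0; have [N [c Hc]] := gs e e0.
  have -> : ip h g = ip h (g - \sum_(k < N) c k *: s k).
    rewrite (ipBr linl sym) (ip_sumr linl sym) big1 ?subr0// => k _.
    by rewrite (ipZr linl sym) hs mulr0.
  apply: le_trans (cauchy_schwarz linl sym pos _ _) _.
  by rewrite ler_wpM2l ?sqr_ge0// lerXn2r ?nnegrE ?(hnorm_ge0 ip) ?ltW.
apply/ler_addgt0Pr => e e0; rewrite add0r.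
have h0 : 0 < hnorm h ^+ 2 + 1 by rewrite ltr_wpDl// sqr_ge0.
(* This radius turns the bound of [key] into at most [e]; the added 1 keeps the denominator positive
   when [h = 0]. *)
apply: le_trans (key (Num.sqrt (e / (hnorm h ^+ 2 + 1))) _) _.
  by rewrite sqrtr_gt0 divr_gt0.
have d0 : 0 <= e / (hnorm h ^+ 2 + 1) by rewrite divr_ge0// ltW.
rewrite (sqr_sqrtr d0).
by rewrite mulrA ler_pdivrMr// mulrC ler_pM2l// lerDl.
Qed.

(* The frame inequality only concerns the span of [s], but testing [h] against
   [g], the partial sum of [sum <h, s_k> s_k], transfers its upper bound to every [h]. *)
Lemma frame_bessel s (A B : R) : is_frame ip s A B ->
  forall h N, \sum_(k < N) cmod2 (ip h (s k)) <= B * hnorm h ^+ 2.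
Proof.
move=> [A0 [AB fr]] h N; have B0 : 0 < B by exact: lt_le_trans AB.
pose g := \sum_(k < N) ip h (s k) *: s k.
have gB : \sum_(k < N) cmod2 (ip g (s k)) <= B * hnorm g ^+ 2.
  have /andP[_] := fr g (in_cspan_sum s N (fun k => ip h (s k))).
  rewrite -lee_fin; apply: le_trans; rewrite -sumEFin.
  rewrite -(big_mkord predT (fun k => (cmod2 (ip g (s k)))%:E)).
  by apply: nneseries_lim_ge => k _ _; rewrite lee_fin cmod2_ge0.
set a := \sum_(k < N) cmod2 (ip h (s k)).
have a0 : 0 <= a by apply: sumr_ge0 => k _; exact: cmod2_ge0.
have hg : Re (ip h g) = a.
  rewrite (ip_sumr linl sym) Re_sum; apply: eq_bigr => k _.
  by rewrite (ipZr linl sym) mulrC mulJ_cmod2.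
(* Young's inequality term by term with weight [B]; by [gB] the second half is at most [|g|^2], so
   that in fact [|g|^2 <= B * a]. *)
have gg : hnorm g ^+ 2 <= (B * a + hnorm g ^+ 2) / 2.
  rewrite {1}(hnorm_sq pos) {2}/g (ip_sumr linl sym) Re_sum.
  apply: (@le_trans _ _ (\sum_(k < N) (B * cmod2 (ip h (s k)) + B^-1 * cmod2 (ip g (s k))) / 2)).
    apply: ler_sum => k _; rewrite (ipZr linl sym) -cconjE.
    case: (ip h (s k)) => b c; case: (ip g (s k)) => d e; rewrite /cmod2/= ler_pdivlMr//.
    have := sqr_ge0 (B * b - d); have := sqr_ge0 (B * c - e) => H1 H2.
    by rewrite -(ler_pM2l B0) [leRHS]mulrDr mulVKf ?gt_eqF//; lra.
  rewrite -mulr_suml big_split -!mulr_sumr ler_pM2r// lerD2l.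
  by rewrite ler_pdivrMl.
(* Since [<h, g> = a], this reads [2 a <= B |h|^2 + B^-1 |g|^2], and the last term is at most
   [a]. *)
have := young linl sym pos h g B0; rewrite hg.
have : B^-1 * hnorm g ^+ 2 <= a by rewrite ler_pdivrMl//; lra.
lra.
Qed.

(** * The Gram matrix [Sigma]: convergence, invertibility and lower bound *)

Section Finite.
Variables (s w : nat -> V) (n : nat).
Local Open Scope sesquilinear_scope.

Definition wcomb (x : 'cV[C]_n) : V := \sum_(i < n) x i 0 *: w i.
(* [arow j] is the conjugate transpose of the paper's [v_j]. *)
Definition arow (j : nat) : 'rV[C]_n := \row_i ip (w i) (s j).

Lemma iota_nE (x : 'cV[C]_n) (i : 'I_n) : iota_n x i = x i 0.
Proof.
rewrite /iota_n; case: eqP => [H|/negP]; last by rewrite ltn_ord.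
by congr (x _ 0); apply: val_inj.
Qed.

Lemma iota_n_out (x : 'cV[C]_n) k : (n <= k)%N -> iota_n x k = 0.
Proof. by move=> nk; rewrite /iota_n; case: eqP => // H; have := H; rewrite {1}ltnNge nk. Qed.

Lemma synth_iota x : synth ip w (iota_n x) = wcomb x.
Proof.
rewrite (synth_finite _ (@iota_n_out x)).
by apply: eq_bigr => i _; rewrite iota_nE.
Qed.

Lemma wcomb_linear a x y : wcomb (a *: x + y) = a *: wcomb x + wcomb y.
Proof.
rewrite /wcomb scaler_sumr -big_split; apply: eq_bigr => i _.
by rewrite !mxE scalerDl scalerA.
Qed.

Lemma wcombD x y : wcomb (x + y) = wcomb x + wcomb y.
Proof. by have := wcomb_linear 1 x y; rewrite !scale1r. Qed.

Lemma wcombB x y : wcomb (x - y) = wcomb x - wcomb y.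
Proof. by have := wcomb_linear (-1) y x; rewrite !scaleN1r !(addrC (- _)). Qed.

Lemma wcombZ a x : wcomb (a *: x) = a *: wcomb x.
Proof.
rewrite /wcomb scaler_sumr; apply: eq_bigr => i _.
by rewrite !mxE scalerA.
Qed.

Lemma wcomb_delta i : wcomb (delta_mx i 0) = w i.
Proof.
rewrite /wcomb (bigD1 i)//= mxE !eqxx scale1r big1 ?addr0// => j ji.
by rewrite mxE (negPf ji) scale0r.
Qed.

Lemma arow_mul j x : (arow j *m x) 0 0 = ip (wcomb x) (s j).
Proof.
rewrite mxE (ip_suml linl); apply: eq_bigr => i _.
by rewrite mxE (ipZl linl) mulrC.
Qed.

Lemma vvecE j : vvec ip s w n j = (arow j)^t*.
Proof.
apply/matrixP => i k; rewrite !mxE /Uadj /anal synth_ebasis.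
by rewrite (ipC sym).
Qed.

Lemma arow_eq0 j : vvec ip s w n j = 0 -> arow j = 0.
Proof.
rewrite -[arow j]trmxCK -vvecE => ->.
by apply/matrixP => i k; rewrite !mxE conjC0.
Qed.

Lemma rnorm2_arow j : rnorm2 (arow j) = vnorm (vvec ip s w n j) ^+ 2.
Proof. by rewrite vvecE vnorm_sq; apply: eq_bigr => i _; rewrite !mxE cmod2J. Qed.

Lemma Uop_delta i : Uop ip s w (iota_n (delta_mx i 0 : 'cV[C]_n)) = anal ip s (w i).
Proof. by rewrite /Uop synth_iota wcomb_delta. Qed.

Variables (A B Cc D : R).
Hypothesis Hs : is_frame ip s A B.
Hypothesis Hw : is_riesz ip w Cc D.
Hypothesis HAi : forall h, in_cspan ip w h -> in_cspan_perp ip s h -> h = 0.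
Local Notation Sig := (Sigma ip s w n).

(** Lower Riesz bound at the finitely supported sequence [iota_n x], whose synthesis is
    [wcomb x]. *)
Lemma wcomb_eq0 x : wcomb x = 0 -> x = 0.
Proof.
have [C0 [_ rz]] := Hw; move=> x0.
have l2x : is_l2 (iota_n x).
  exists (\sum_(k < n) cmod2 (iota_n x k)) => N.
  apply: (@le_trans _ _ (\sum_(k < maxn N n) cmod2 (iota_n x k))).
    rewrite -!(big_mkord predT (fun k => cmod2 (iota_n x k))).
    rewrite (@big_cat_nat _ _ _ N 0 (maxn N n))//= ?leq_maxl// lerDl sumr_ge0// => j _.
    exact: cmod2_ge0.
  rewrite (@sum_stationary _ (fun k => cmod2 (iota_n x k)) n) ?leq_maxr// => j nj.
  by rewrite iota_n_out// cmod2_0.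
have [y [/hconv_unique yE /andP[+ _]]] := rz _ l2x.
have cx : hconv ip (psum w (iota_n x)) (wcomb x).
  move=> e e0; exists n => k nk.
  rewrite /psum (@sum_stationary _ (fun k => iota_n x k *: w k) n)// => [|j nj].
    rewrite /wcomb; under eq_bigr do rewrite iota_nE.
    by rewrite subrr (hnorm0 linl).
  by rewrite iota_n_out// scale0r.
rewrite (yE _ cx) x0 (hnorm0 linl) expr0n/= => l2le.
have l20 : (l2norm2 (iota_n x) <= 0)%E.
  by move: l2le; rewrite pmule_rle0 ?lte_fin.
apply/matrixP => i j; rewrite ord1 !mxE -iota_nE; apply: cmod2_eq0; apply/eqP.
rewrite eq_le cmod2_ge0 andbT -lee_fin; apply: le_trans l20.
apply: (@le_trans _ _ (\sum_(0 <= k < i.+1) (cmod2 (iota_n x k))%:E)%E).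
  by rewrite big_nat_recr//= leeDr// sume_ge0// => k _; rewrite lee_fin cmod2_ge0.
by apply: nneseries_lim_ge => k _ _; rewrite lee_fin cmod2_ge0.
Qed.

(** The Bessel bound makes both sequences square-summable, so the [csum] in [Sigma] is a true sum
    and not the default of [xget]. *)
Lemma Sigma_series (i j : 'I_n) :
  cvg_series (fun k => ip (w j) (s k) * (ip (w i) (s k))^*) (Sig i j).
Proof.
pose M := B * hnorm (w j) ^+ 2 + B * hnorm (w i) ^+ 2.
have B0 : 0 <= B by have [A0 [AB _]] := Hs; exact: le_trans (ltW A0) AB.
have [||l Hl] := @cvg_series_prod R (fun k => ip (w j) (s k)) (fun k => ip (w i) (s k)) M.
- by move=> N; apply: le_trans (frame_bessel Hs _ _) _; rewrite lerDl mulr_ge0 ?sqr_ge0.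
- by move=> N; apply: le_trans (frame_bessel Hs _ _) _; rewrite lerDr mulr_ge0 ?sqr_ge0.
rewrite mxE !Uop_delta /l2ip /anal; under [X in csum X]eq_fun do rewrite cconjE.
by rewrite (cvg_series_csum Hl).
Qed.

(** The form of [Sigma] at [x] is the squared norm of [U iota_n x]: expand both sides over the
    entries of [x] and sum the series of the entries. *)
Lemma Sigma_form x :
  (\sum_(k < N) cmod2 (ip (wcomb x) (s k))) @[N --> \oo] --> Re (dotc (Sig *m x) x).
Proof.
have H : cvg_series (fun k => (cmod2 (ip (wcomb x) (s k)))%:C%C) (dotc (Sig *m x) x).
  rewrite dotcE; under eq_bigr do rewrite mxE mulr_suml.
  rewrite (_ : (fun k => _) = (fun k => \sum_(i < n) \sum_(j < n)
    ((x j 0 * (x i 0)^*) * (ip (w j) (s k) * (ip (w i) (s k))^*)))).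
    apply: cvg_series_sum => i; apply: cvg_series_sum => j.
    have -> : Sig i j * x j 0 * (x i 0)^* = x j 0 * (x i 0)^* * Sig i j by ring.
    exact/cvg_seriesZ/Sigma_series.
  apply/funext => k; rewrite -mulJ_cmod2 (ip_suml linl) rmorph_sum big_distrlr/= exchange_big/=.
  apply: eq_bigr => i _; apply: eq_bigr => j _.
  by rewrite !(ipZl linl) rmorphM/=; ring.
have [+ _] := H; by [].
Qed.

Lemma Sigma_herm : Sig^t* = Sig.
Proof.
have H i j : (Sig j i)^* = Sig i j.
  have <- := cvg_series_csum (cvg_series_conj (Sigma_series j i)).
  rewrite -[RHS](cvg_series_csum (Sigma_series i j)); congr csum.
  by apply/funext => k; rewrite rmorphM/= conjCK mulrC.
by apply/matrixP => i j; rewrite -[RHS]H mxE [in LHS]mxE.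
Qed.

Lemma Sigma_form_ge x N : \sum_(k < N) cmod2 (ip (wcomb x) (s k)) <= Re (dotc (Sig *m x) x).
Proof.
have H := @Sigma_form x; rewrite -(cvg_lim _ H)//.
apply: nondecreasing_cvgn_le; last by apply/cvg_ex; exists (Re (dotc (Sig *m x) x)).
move=> a b ab; rewrite -!(big_mkord predT (fun k => cmod2 (ip (wcomb x) (s k)))).
by rewrite (@big_cat_nat _ _ _ a 0 b)//= lerDl sumr_ge0// => j _; exact: cmod2_ge0.
Qed.

(** For [x] in the kernel the form vanishes, so [wcomb w x] is orthogonal to every [s k]; being in
    the span of [w], it is 0 by [HAi]. *)
Lemma Sigma_unit : Sig \in unitmx.
Proof.
apply: unitmx_ker => x Sx.
apply: wcomb_eq0; apply: HAi.
  pose c := iota_n x; rewrite -synth_iota (synth_finite _ (@iota_n_out x)).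
  exact: in_cspan_sum.
apply: in_cspan_perpP => k; apply: cmod2_eq0; apply/eqP.
rewrite eq_le cmod2_ge0 andbT.
have := Sigma_form_ge x k.+1; rewrite Sx /dotc mulmx0 mxE /=.
apply: le_trans; rewrite big_ord_recr/= lerDr sumr_ge0// => j _; exact: cmod2_ge0.
Qed.

(** Coercivity of [Sigma] in the partial-sum form that [expected_codim] asks for, with [lam] the
    inverse of the norm of [Sigma^-1]. *)
Lemma Sigma_lower (n0 : (0 < n)%N) (x : 'cV[C]_n) (e : R) : 0 < e ->
  exists N0, forall N, (N0 <= N)%N ->
    (mxopnorm (invmx Sig))^-1 * rnorm2 (x^T) - e <= \sum_(j < N) cmod2 ((arow j *m x) 0 0).
Proof.
move=> e0; have /cvgrPdist_le/(_ _ e0)[N0 _ HN] := @Sigma_form x.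
exists N0 => N /HN /=; under [X in _ -> _ <= X]eq_bigr do rewrite arow_mul.
have := coercive n0 Sigma_herm Sigma_unit _ x.
have -> : rnorm2 x^T = vnorm x ^+ 2 by rewrite vnorm_sq; apply: eq_bigr => i _; rewrite mxE.
have P y : 0 <= Re (dotc (Sig *m y) y) by have := Sigma_form_ge y 0; rewrite big_ord0.
move=> /(_ P); rewrite ler_norml => ? /andP[_ ?]; lra.
Qed.
End Finite.
End FrameOperators.

(** * Orthogonal projection onto the complement of a finite span *)

Section Reconstruction.
Variables (R : realType) (V : lmodType R[i]) (ip : V -> V -> R[i]).
Hypothesis HV : is_hilbert ip.
Local Notation C := R[i].
Local Notation Re := (@complex.Re R).
Local Notation hnorm := (hnorm ip).
Local Notation linl := (ip_linl HV).
Local Notation sym := (ip_sym HV).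
Local Notation pos := (ip_pos HV).
Variables (s w : nat -> V) (n : nat).
Hypothesis wfree : forall x : 'cV[C]_n, wcomb w x = 0 -> x = 0.
Local Notation P := (projWnperp ip w n).
Local Notation wcomb := (@wcomb R V w n).
Local Notation arow := (@arow R V ip s w n).
Local Notation vvec := (vvec ip s w n).
Local Open Scope sesquilinear_scope.

(** The predicate that [projWnperp] hands to [xget], named so that existence and uniqueness can be
    stated. *)
Definition is_projWnperp (x y : V) :=
  (forall i : 'I_n, ip y (w i) = 0) /\
  exists c : 'I_n -> C, x - y = \sum_(i < n) c i *: w i.

Lemma ip_wcomb y x : (forall i : 'I_n, ip y (w i) = 0) -> ip y (wcomb x) = 0.
Proof.
move=> yw; rewrite (ip_sumr linl sym) big1// => i _.
by rewrite (ipZr linl sym) yw mulr0.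
Qed.

Lemma sum_wcomb (c : 'I_n -> C) : \sum_(i < n) c i *: w i = wcomb (\col_i c i).
Proof. by apply: eq_bigr => i _; rewrite mxE. Qed.

(** The difference [y - z] lies in the span of the first [n] vectors [w i] and is orthogonal to
    it. *)
Lemma projWnperp_unique x y z : is_projWnperp x y -> is_projWnperp x z -> y = z.
Proof.
move=> [yw [c cE]] [zw [d dE]]; apply/eqP; rewrite -subr_eq0; apply/eqP/(ip_def HV).
have yz i : ip (y - z) (w (i : 'I_n)) = 0 by rewrite (ipBl linl) yw zw subrr.
have {2}-> : y - z = (x - z) - (x - y) by rewrite opprB [x - z]addrC addrACA subrr addr0 addrC.
by rewrite cE dE !sum_wcomb (ipBr linl sym) !ip_wcomb// subrr.
Qed.

(** Solve for the coefficients with the Gram matrix of the [w i], which is invertible by [wfree]. *)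
Lemma projWnperp_exists x : exists y, is_projWnperp x y.
Proof.
pose G : 'M[C]_n := \matrix_(i, j) ip (w j) (w i).
have GE y : G *m y = \col_i ip (wcomb y) (w i).
  apply/matrixP => i k; rewrite ord1 !mxE (ip_suml linl); apply: eq_bigr => j _.
  by rewrite mxE (ipZl linl) mulrC.
have Gu : G \in unitmx.
  apply: unitmx_ker => y; rewrite GE => Gy; apply: wfree; apply: (ip_def HV).
  by apply: ip_wcomb => i; move/matrixP: Gy => /(_ i 0); rewrite !mxE.
pose c := invmx G *m \col_i ip x (w i).
exists (x - wcomb c); split.
  move=> i; rewrite (ipBl linl); apply/eqP; rewrite subr_eq0; apply/eqP.
  have := GE c; rewrite mulKVmx// => /matrixP/(_ i 0); by rewrite !mxE.
by exists (fun i => c i 0); rewrite opprB addrC subrK.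
Qed.

Lemma projWnperpP x : is_projWnperp x (P x).
Proof.
have [y xy] := projWnperp_exists x.
by apply: (xgetPex 0 (P := [set y | is_projWnperp x y])); exists y.
Qed.

Lemma projWnperp_eq x y : is_projWnperp x y -> P x = y.
Proof. exact: projWnperp_unique (projWnperpP x). Qed.

Lemma projWnperpZ a x : P (a *: x) = a *: P x.
Proof.
have [xw [c cE]] := projWnperpP x; apply: projWnperp_eq; split.
  by move=> i; rewrite (ipZl linl) xw mulr0.
by exists (fun i => a * c i); rewrite -scalerBr cE scaler_sumr; under eq_bigr do rewrite scalerA.
Qed.

Lemma projWnperp_id x : P (P x) = P x.
Proof.
have [xw [c cE]] := projWnperpP x; apply: projWnperp_eq; split => //.
by exists (fun=> 0); rewrite subrr big1// => i _; rewrite scale0r.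
Qed.

Lemma projWnperp_le x : hnorm (P x) <= hnorm x.
Proof.
have [xw [c cE]] := projWnperpP x.
rewrite -(@ler_sqr _ (hnorm _)) ?nnegrE ?(hnorm_ge0 ip)//.
have {2}-> : x = P x + (x - P x) by rewrite addrC subrK.
rewrite cE sum_wcomb (hnormD_sq linl sym pos) ip_wcomb//= mulr0 addr0 lerDl.
exact: sqr_ge0.
Qed.

(** * Empirical Gram matrix and cross-term as finite sums over the draws *)

Variables (p : nat -> R) (m : nat) (om : {ffun 'I_m -> nat}).
Local Notation Sh := (Sigmahat ip s w n p om).
Local Notation Gh := (Gammahat ip s w n p om).

Definition wt (t : 'I_m) : R := m%:R^-1 * (p (om t))^-1.

(** Exchanging the sums leaves one term per draw, repeated indices being counted each time. [U] is
    general because [Sigmahat] needs scalar sums and [Gammahat] sums in [V]. *)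
Lemma sum_Qop (U : lmodType C) (x : nat -> C) (g : nat -> U) N :
  (forall t, (om t < N)%N) ->
  \sum_(k < N) Qop p om x k *: g k = \sum_(t < m) ((wt t)%:C%C * x (om t)) *: g (om t).
Proof.
move=> omN; under eq_bigr do rewrite /Qop scaler_suml.
rewrite exchange_big/=; apply: eq_bigr => t _.
rewrite (bigD1 (Ordinal (omN t)))//= eqxx mul1r big1 ?addr0// => k kt.
suff -> : (om t == k) = false by rewrite mul0r mulr0 scale0r.
by apply: contraNF kt => /eqP E; apply/eqP/val_inj; rewrite /= E.
Qed.

(** From this index on [Qop] vanishes, which turns the series in [Sigmahat] and [Gammahat] into
    finite sums. *)
Definition ombound := (\max_t om t).+1.
Lemma lt_ombound t : (om t < ombound)%N.
Proof. by rewrite ltnS; exact: leq_bigmax. Qed.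

Lemma Qop_out x k : (ombound <= k)%N -> Qop p om x k = 0.
Proof.
move=> Nk; rewrite /Qop big1// => t _.
by rewrite ltn_eqF ?mul0r ?mulr0// (leq_trans (lt_ombound t)).
Qed.

Lemma SigmahatE : Sh = \sum_(t < m) (wt t)%:C%C *: ((arow (om t))^t* *m arow (om t)).
Proof.
apply/matrixP => i j; rewrite mxE !Uop_delta// /l2ip.
rewrite (csum_finite (N := ombound)) => [|k Nk]; last by rewrite Qop_out// mul0r.
have := sum_Qop (anal ip s (w j)) (fun k => cconj (anal ip s (w i) k) : C^o) lt_ombound.
move=> /= E; rewrite [LHS]E summxE; apply: eq_bigr => t _.
rewrite !mxE big_ord1 !mxE /anal cconjE -[_ *: _]/(_ * _); ring.
Qed.

Lemma GammahatE h : Gh h = \sum_(t < m) ((wt t)%:C%C * ip (P h) (s (om t))) *: (arow (om t))^t*.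
Proof.
apply/matrixP => i j; rewrite ord1 mxE /Uadj (synth_finite HV _ (N := ombound)); last first.
  by move=> k; exact: Qop_out.
rewrite sum_Qop; last exact: lt_ombound.
rewrite /anal (ip_suml linl) summxE; apply: eq_bigr => t _.
by rewrite (ipZl linl) !mxE (ipC sym (w i)).
Qed.

Lemma GammahatZ a h : Gh (a *: h) = a *: Gh h.
Proof.
rewrite !GammahatE scaler_sumr; apply: eq_bigr => t _.
by rewrite projWnperpZ (ipZl linl) scalerA; congr (_ *: _); ring.
Qed.

Lemma Gammahat_proj h : Gh (P h) = Gh h.
Proof. by rewrite !GammahatE projWnperp_id. Qed.

Lemma Sh_mul x : Sh *m x = \sum_(t < m) ((wt t)%:C%C * ip (wcomb x) (s (om t))) *: (arow (om t))^t*.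
Proof.
rewrite SigmahatE mulmx_suml; apply: eq_bigr => t _.
rewrite -scalemxAl -mulmxA [arow _ *m x]mx11_scalar arow_mul// mul_mx_scalar.
by rewrite scalerA.
Qed.

Lemma dotc_arow t x : dotc ((arow t)^t*) x = (ip (wcomb x) (s t))^*.
Proof.
rewrite -(arow_mul HV) dotcE mxE rmorph_sum; apply: eq_bigr => i _.
by rewrite !mxE rmorphM/= mulrC.
Qed.

(** If [Sh] kills [x], its form at [x], a weighted sum of squares, is 0; hence every drawn row kills
    [x], and these rows span. *)
Lemma Sigmahat_unit :
  (forall j, 0 <= p j) -> (forall j, vvec j != 0 -> 0 < p j) -> (0 < m)%N ->
  \rank (\sum_(t < m) <<arow (om t)>>)%MS = n -> Sh \in unitmx.
Proof.
move=> p0 pv m0 rk; apply: unitmx_ker => x Sx.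
have c0 t : 0 <= wt t by rewrite mulr_ge0 ?invr_ge0.
have E : \sum_(t < m) wt t * cmod2 (ip (wcomb x) (s (om t))) = 0.
  have : Re (dotc (Sh *m x) x) = 0 by rewrite Sx /dotc mulmx0 mxE.
  rewrite Sh_mul (ip_suml (@dotc_linl R n)) Re_sum => form0; rewrite -[RHS]form0.
  apply: eq_bigr => t _; rewrite (ipZl (@dotc_linl R n)) dotc_arow ReZlM.
  by rewrite mulJ_cmod2.
have sub : (\sum_(t < m) <<arow (om t)>> <= kermx x)%MS.
  apply/sumsmx_subP => t _; rewrite genmxE; apply/sub_kermxP.
  rewrite [LHS]mx11_scalar arow_mul//.
  (* [om] is an arbitrary tuple, so [p (om t)] may be 0; a zero row kills [x] anyway, and a nonzero
     one has positive weight by [pv]. *)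
  have [vz|/pv pt] := eqVneq (vvec (om t)) 0.
    by rewrite -arow_mul// (arow_eq0 HV vz) mul0mx mxE raddf0.
  move: E => /eqP; rewrite psumr_eq0 => [/allP/(_ t)|i _]; last by rewrite mulr_ge0 ?cmod2_ge0.
  rewrite mem_index_enum => /(_ isT); rewrite mulf_eq0 gt_eqF/=; last first.
    by rewrite mulr_gt0 ?invr_gt0 ?ltr0n.
  by move=> /eqP/cmod2_eq0 ->; rewrite raddf0.
have : row_full (kermx x) by rewrite /row_full eqn_leq rank_leq_col -{1}rk mxrankS.
by rewrite -sub1mx => /sub_kermxP; rewrite mul1mx.
Qed.

(** * Weighted least squares: minimizer, uniqueness and error bound *)

Variable f : V.
Hypothesis p_ge0 : forall j, 0 <= p j.
Hypothesis m_gt0 : (0 < m)%N.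
Hypothesis Shu : Sh \in unitmx.
Local Notation J := (@wls_obj R V ip s w n p f m om).

(** Right-hand side of the normal equations: the operator [iota_n^* U^* Q S^*] applied to [f]. *)
Definition wls_rhs : 'cV[C]_n :=
  \sum_(t < m) ((wt t)%:C%C * ip f (s (om t))) *: (arow (om t))^t*.
Definition wls_sol : 'cV[C]_n := invmx Sh *m wls_rhs.

(** The factor [m] undoes the [m%:R^-1] inside [wt]. *)
Lemma wls_objE x : J x = m%:R * \sum_(t < m) wt t * cmod2 (ip (wcomb x - f) (s (om t))).
Proof.
rewrite mulr_sumr; apply: eq_bigr => t _.
by rewrite synth_iota// (ipBl linl) /wt !mulrA divff ?mul1r// pnatr_eq0 -lt0n.
Qed.

(* The cross term vanishes by the normal equations [Sh *m wls_sol = wls_rhs]. *)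
Lemma wls_decomp x :
  J x = J wls_sol + m%:R * \sum_(t < m) wt t * cmod2 (ip (wcomb (x - wls_sol)) (s (om t))).
Proof.
set d := x - wls_sol; rewrite !wls_objE -mulrDr; congr (_ * _).
have cross : \sum_(t < m) wt t *
    Re (ip (wcomb wls_sol - f) (s (om t)) * (ip (wcomb d) (s (om t)))^*) = 0.
  have : Re (dotc (Sh *m wls_sol - wls_rhs) d) = 0.
    by rewrite mulKVmx// subrr /dotc mulmx0 mxE.
  rewrite Sh_mul /wls_rhs -sumrB (ip_suml (@dotc_linl R n)) Re_sum => form0; rewrite -[RHS]form0.
  apply: eq_bigr => t _; rewrite -scalerBl (ipZl (@dotc_linl R n)) dotc_arow -mulrBr.
  by rewrite -(ipBl linl) ReZlM.
have -> : wcomb x - f = (wcomb wls_sol - f) + wcomb d.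
  by rewrite [RHS]addrC wcombB [RHS]addrA subrK.
have sq a b : cmod2 (a + b) = cmod2 a + cmod2 b + 2 * Re (a * b^*).
  by rewrite -cconjE; case: a => a1 a2; case: b => b1 b2; rewrite /cmod2/=; ring.
have H t : wt t * cmod2 (ip (wcomb wls_sol - f + wcomb d) (s (om t))) =
    wt t * cmod2 (ip (wcomb wls_sol - f) (s (om t))) +
    wt t * cmod2 (ip (wcomb d) (s (om t))) +
    2 * (wt t * Re (ip (wcomb wls_sol - f) (s (om t)) * (ip (wcomb d) (s (om t)))^*)).
  by rewrite (ipDl linl) sq; ring.
rewrite (eq_bigr _ (fun t _ => H t)) 2!big_split/=.
by rewrite -[X in _ + X]mulr_sumr cross mulr0 addr0.
Qed.

Lemma wls_sol_min y : J wls_sol <= J y.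
Proof.
rewrite (wls_decomp y) lerDl mulr_ge0// sumr_ge0// => t _.
by rewrite mulr_ge0 ?cmod2_ge0// mulr_ge0 ?invr_ge0.
Qed.

(** At a minimizer the excess in [wls_decomp] vanishes term by term, so [Sh] kills [x - wls_sol]. *)
Lemma wls_sol_unique x : (forall y, J x <= J y) -> x = wls_sol.
Proof.
move=> /(_ wls_sol); rewrite (wls_decomp x) gerDl pmulr_rle0 ?ltr0n// => le0.
have c0 t : 0 <= wt t * cmod2 (ip (wcomb (x - wls_sol)) (s (om t))).
  by rewrite mulr_ge0 ?cmod2_ge0// mulr_ge0 ?invr_ge0.
have /eqP : \sum_(t < m) wt t * cmod2 (ip (wcomb (x - wls_sol)) (s (om t))) = 0.
  by apply/eqP; rewrite eq_le le0 sumr_ge0.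
rewrite psumr_eq0// => /allP z.
apply/eqP; rewrite -subr_eq0; apply/eqP; rewrite -(mulKmx Shu (x - wls_sol)).
rewrite Sh_mul big1 ?mulmx0// => t _.
have := z t; rewrite mem_index_enum => /(_ isT); rewrite mulf_eq0 => /orP[/eqP->|/eqP/cmod2_eq0 ->].
  by rewrite mul0r scale0r.
by rewrite mulr0 scale0r.
Qed.

(** Write [f = P f + wcomb x]. Least squares reproduces [wcomb x] exactly, and only [P f] enters
    through the cross-term. *)
Lemma f_wls_sol : f - wcomb wls_sol = P f - wcomb (invmx Sh *m Gh f).
Proof.
have [_ [c cE]] := projWnperpP f; move: cE; rewrite sum_wcomb; set x := \col_i c i => fE.
have rE : wls_rhs = Sh *m x + Gh f.
  rewrite Sh_mul GammahatE -big_split; apply: eq_bigr => t _ /=.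
  by rewrite -scalerDl -mulrDr -(ipDl linl) -fE subrK.
rewrite /wls_sol rE mulmxDr mulKmx// wcombD -fE opprD addrA; congr (_ - _).
by rewrite opprB addrC subrK.
Qed.

Lemma le_Kconst h :
  hnorm (wcomb (invmx Sh *m Gh h)) <= Kconst ip s w n p om * hnorm h.
Proof.
rewrite /Kconst.
rewrite (_ : (fun h => synth ip w (iota_n (invmx Sh *m Gh h))) =
             (fun h => wcomb (invmx Sh *m Gh h))); last first.
  by apply/funext => h'; rewrite synth_iota.
pose z t := wcomb (invmx Sh *m (arow (om t))^t*).
(* A finite bound from Cauchy-Schwarz at each draw and the contraction [P]; it makes the supremum in
   [Kconst] a genuine one. *)
pose M := \sum_(t < m) wt t * hnorm (s (om t)) * hnorm (z t).
have c0 t : 0 <= wt t by rewrite mulr_ge0 ?invr_ge0.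
apply: (le_opnorm (N := hnorm) (N' := hnorm) (T := fun h => wcomb (invmx Sh *m Gh h)) (M := M)).
- by move=> a x; exact: hnormZr linl sym pos _ _.
- by move=> a x; exact: hnormZr linl sym pos _ _.
- by move=> a x; rewrite GammahatZ -scalemxAr wcombZ.
- exact: hnorm_ge0.
- apply: sumr_ge0 => t _; rewrite mulr_ge0 ?(hnorm_ge0 ip)//.
  by rewrite mulr_ge0 ?(hnorm_ge0 ip)//; exact: c0.
move=> x.
have -> : wcomb (invmx Sh *m Gh x) =
    \sum_(t < m) ((wt t)%:C%C * ip (P x) (s (om t))) *: z t.
  rewrite GammahatE mulmx_sumr.
  have -> (F : 'I_m -> 'cV[C]_n) : wcomb (\sum_t F t) = \sum_t wcomb (F t).
    by apply: (big_morph wcomb (@wcombD _ _ w n)); rewrite -(scale0r 0) wcombZ scale0r.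
  by apply: eq_bigr => t _; rewrite -scalemxAr wcombZ.
apply: le_trans (hnorm_sum linl sym pos _ _ _) _; rewrite mulr_suml; apply: ler_sum => t _.
rewrite (hnormZ linl sym pos) cmod2M sqrtrM ?cmod2_ge0// cmod2_real sqrtr_sqr ger0_norm//.
have -> : wt t * hnorm (s (om t)) * hnorm (z t) * hnorm x =
    wt t * (hnorm x * hnorm (s (om t))) * hnorm (z t) by ring.
rewrite ler_wpM2r ?(hnorm_ge0 ip)// ler_wpM2l//.
apply: le_trans (cs_norm linl sym pos _ _) _.
by rewrite ler_wpM2r ?(hnorm_ge0 ip)// projWnperp_le.
Qed.

Lemma good_event_unit : good_event ip s w n p f om.
Proof.
split => //; exists wls_sol; split; first exact: wls_sol_min.
split; first exact: wls_sol_unique.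
(* Replacing [f] by [P f] in the cross-term lets [Kconst] multiply the norm of [P f] instead of that
   of [f]. *)
rewrite synth_iota// f_wls_sol -Gammahat_proj; set g := P f; set T := wcomb _.
have [gw _] := projWnperpP f.
have K := le_Kconst g.
rewrite -(@ler_sqr _ (hnorm _)) ?nnegrE ?mulr_ge0 ?sqrtr_ge0 ?(hnorm_ge0 ip)//.
rewrite exprMn [X in _ <= _ * X]sqr_sqrtr; last by rewrite addr_ge0// sqr_ge0.
rewrite (hnormB_sq linl sym pos) ip_wcomb//= mulr0 subr0 mulrDr mulr1 lerD2l.
rewrite mulrC -exprMn lerXn2r ?nnegrE ?(hnorm_ge0 ip)//.
by apply: le_trans K; exact: hnorm_ge0.
Qed.
End Reconstruction.

(** * Probability that the draws span *)

Section SpanningProbability.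
Variables (R : realType) (p : nat -> R) (lam K : R) (n : nat) (a : nat -> 'rV[R[i]]_n).
Hypothesis p_ge0 : forall j, 0 <= p j.
Hypothesis p_sum : (\sum_(j <oo) (p j)%:E = 1)%E.
Hypothesis K_gt0 : 0 < K.
Hypothesis a_le : forall j, rnorm2 (a j) <= K * p j.
Hypothesis a_lower : forall (x : 'cV[R[i]]_n) (e : R), 0 < e ->
  exists N0, forall N, (N0 <= N)%N ->
    lam * rnorm2 (x^T) - e <= \sum_(j < N) cmod2 ((a j *m x) 0 0).

(* Markov's inequality for the codimension of the span of the draws. *)
Lemma prob_span m (G : set {ffun 'I_m -> nat}) (d : R) :
  (forall om : {ffun 'I_m -> nat}, \rank (\sum_(t < m) <<a (om t)>>)%MS = n -> G om) ->
  expR (- (lam / K * m%:R)) * n%:R <= d ->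
  ((1 - d)%:E <= iid_prob p G)%E.
Proof.
move=> full small.
have pos (om : {ffun 'I_m -> nat}) : (0 <= (\prod_(t < m) p (om t))%:E)%E.
  by rewrite lee_fin weight_ge0.
have bad : (\esum_(om in setT `&` ~` G) (\prod_(t < m) p (om t))%:E <= d%:E)%E.
  (* The process starts at [L = 0], of codimension [n]. *)
  have := codim_decay p_ge0 (expected_codim p_ge0 p_sum K_gt0 a_le a_lower) m 0.
  rewrite mxrank0 subn0 => decay; apply: (le_trans _ (le_trans decay _)); last by rewrite lee_fin.
  rewrite esum_mkcondr; apply: le_esum => om _.
  case: ifPn => [|_]; last by rewrite mule_ge0// lee_fin.
  (* Outside [G] the draws do not span, so the codimension is at least 1 and multiplying by it
     cannot decrease the weight. *)
  rewrite inE => /= nG; rewrite lee_pemulr// lee_fin ler1n subn_gt0 ltn_neqAle rank_leq_col andbT.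
  by rewrite adds0mx; apply: contra_not_neq nG; exact: full.
have := iid_prob_setT p_ge0 m p_sum; rewrite /iid_prob.
rewrite (esumID G) => [|om _]; last exact: pos.
rewrite setTI EFinB leeBlDr// => <-.
by rewrite leeD2l// (le_trans _ bad).
Qed.
End SpanningProbability.

(** * Row norms against the sampling distribution *)

Section SamplingConstant.
Variables (R : realType) (V : lmodType R[i]) (ip : V -> V -> R[i]).
Variables (s w : nat -> V) (n : nat) (p : nat -> R).
Hypothesis HV : is_hilbert ip.
Hypothesis p_ge0 : forall j, 0 <= p j.
Hypothesis vvec_p : forall j, vvec ip s w n j != 0 -> 0 < p j.
Hypothesis Rfin : (Rconst ip s w n p < +oo)%E.

(** The supremum controls only the indices with [0 < p j]; at the others [vvec_p] makes the row
    zero. *)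
Lemma rnorm2_arow_le j : rnorm2 (arow ip s w n j) <= fine (Rconst ip s w n p) * p j.
Proof.
rewrite (rnorm2_arow HV); have [pj0|pjn0] := eqVneq (p j) 0.
  have -> : vvec ip s w n j = 0.
    by apply/eqP; apply: contraT => /vvec_p; rewrite pj0 ltxx.
  rewrite (_ : vnorm 0 = 0) ?expr0n ?pj0 ?mulr0//.
  by rewrite vnormE (hnorm0 (@dotc_linl R n)).
have pj : 0 < p j by rewrite lt_def pjn0 p_ge0.
have le : ((vnorm (vvec ip s w n j) ^+ 2 / p j)%:E <= Rconst ip s w n p)%E.
  by apply: ereal_sup_ubound; exists j.
rewrite -ler_pdivrMr// -lee_fin fineK// fin_numE -ltey Rfin andbT.
(* [fine] is faithful here: the supremum lies above a real number, hence is not minus infinity. *)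
by apply: contraTneq le => ->; rewrite leNgt ltNyr.
Qed.

Lemma Rconst_gt0 j : vvec ip s w n j != 0 -> 0 < fine (Rconst ip s w n p).
Proof.
move=> vj; have pj := vvec_p vj; rewrite -(pmulr_lgt0 _ pj).
apply: lt_le_trans (rnorm2_arow_le j); rewrite (rnorm2_arow HV) exprn_gt0//.
by rewrite lt_def vnorm_ge0 andbT; apply: contra_neq vj => /vnorm_eq0.
Qed.
End SamplingConstant.

Unset Implicit Arguments.
Set Printing Implicit Defensive.

Theorem theorem3p1 (R : realType) (V : lmodType R[i]) (ip : V -> V -> R[i])
  (HV : is_hilbert ip)
  (s w : nat -> V) (A B Cc D : R)
  (Hs : is_frame ip s A B) (Hw : is_riesz ip w Cc D)
  (n : nat) (Hn : (0 < n)%N)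
  (p : nat -> R) (Hp : is_prob p)
  (* (A)(i): W cap S^perp = {0} *)
  (HAi : forall h, in_cspan ip w h -> in_cspan_perp ip s h -> h = 0)
  (* (A)(ii): R < oo and R' < oo *)
  (HAii : (Rconst ip s w n p < +oo)%E /\ (Rconst' ip s w n p < +oo)%E)
  (* (A)(iii) *)
  (HAiii : forall j, vvec ip s w n j != 0 -> 0 < p j) :
  let Rc := fine (Rconst ip s w n p) in
  let Sig := Sigma ip s w n in
  Sig \in unitmx /\
  forall (f : V) (delta : R), 0 < delta < 1 ->
  forall m : nat, (0 < m)%N ->
    8 / 3 * Rc * mxopnorm Sig * mxopnorm (invmx Sig) ^+ 2 * ln (2 * n%:R / delta) <= m%:R ->
    ((1 - delta)%:E <= iid_prob p [set om : {ffun 'I_m -> nat} | good_event ip s w n p f om])%E.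
Proof.
move=> Rc Sig; have [p0 p1] := Hp.
have Su : Sig \in unitmx. by exact: (Sigma_unit HV n Hs Hw HAi).
split => // f delta /andP[d0 d1] m m0 Hm.
have lower := Sigma_lower HV Hs Hw HAi Hn.
set k := mxopnorm (invmx Sig) in Hm lower.
have k0 : 0 < k by exact: mxopnorm_inv_gt0.
(* Were all rows zero, the lower bound at a unit vector, with tolerance half of [k^-1], would give
   [k^-1 / 2 <= 0]. *)
have [j vj] : exists j, vvec ip s w n j != 0.
  apply: contrapT => /forallNP v0.
  pose x : 'cV[R[i]]_n := delta_mx (Ordinal Hn) 0.
  have rx : rnorm2 (x^T) = 1.
    rewrite /rnorm2 (bigD1 (Ordinal Hn))//= !mxE !eqxx big1 ?addr0 => [|i iO].
      by rewrite cmod2_real expr1n.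
    by rewrite !mxE (negPf iO) cmod2_0.
  have e0 : 0 < k^-1 / 2 by rewrite divr_gt0 ?invr_gt0.
  have [N0 /(_ N0 (leqnn _))] := lower x _ e0.
  rewrite rx mulr1 big1 => [|j _]; first by have : 0 < k^-1 by [rewrite invr_gt0]; lra.
  have /negP := v0 j; rewrite negbK => /eqP vj.
  by rewrite (arow_eq0 HV vj) mul0mx mxE cmod2_0.
have Rc0 : 0 < Rc by exact: (Rconst_gt0 HV p0 HAiii HAii.1 vj).
apply: (@prob_span _ p k^-1 Rc n (arow ip s w n)) => //.
- exact: (rnorm2_arow_le HV p0 HAiii HAii.1).
- move=> om full; apply: good_event_unit => //; first exact: (wcomb_eq0 HV Hw).
  exact: Sigmahat_unit.
have n0 : 0 < n%:R :> R by rewrite ltr0n.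
set l := ln _ in Hm.
have l0 : 0 <= l.
  apply: ln_ge0; rewrite ler_pdivlMr// mul1r.
  by have : 1 <= n%:R :> R; [rewrite ler1n|lra].
have Sk : 1 <= mxopnorm Sig * k by exact: mxopnorm_mul_inv.
(* The assumed bound on [m] is [l * (k * Rc)] times [8 / 3 * (mxopnorm Sig * k)], and the latter
   factor is at least 1. *)
have lm : l <= k^-1 / Rc * m%:R.
  rewrite -invfM mulrC ler_pdivlMr ?mulr_gt0//; apply: le_trans Hm.
  have -> : 8 / 3 * Rc * mxopnorm Sig * k ^+ 2 * l =
    8 / 3 * (mxopnorm Sig * k) * (l * (k * Rc)) by ring.
  rewrite ler_peMl ?mulr_ge0 ?(ltW k0) ?(ltW Rc0)//; lra.
(* The expected codimension is then at most [n] times [delta / (2 n)], that is [delta / 2]. *)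
have El : expR (- l) = delta / (2 * n%:R).
  by rewrite expRN lnK ?posrE ?divr_gt0 ?mulr_gt0// invf_div.
apply: (@le_trans _ _ (expR (- l) * n%:R)).
  by rewrite ler_pM2r// ler_expR lerN2.
rewrite El (_ : delta / (2 * n%:R) * n%:R = delta / 2); first by lra.
by field; rewrite gt_eqF.
Qed.
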